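(* Let $k$ be a field, $\mathfrak S$ a $k$-linear Grothendieck category, $H$ a cosemisimple Hopf algebra over $k$ and $A$ a right $H$-comodule algebra. Consider the full subcategories $$\mathcal T({}_A\mathfrak S^H)=\{\mathcal M\in{}_A\mathfrak S^H\mid\mathfrak C^H(\mathcal M)=0\},\qquad\mathcal F({}_A\mathfrak S^H)=\{\mathcal M\in{}_A\mathfrak S^H\mid{}_A\mathfrak K^H(\mathcal M)=0\}.$$ Then the pair $(\mathcal T({}_A\mathfrak S^H),\mathcal F({}_A\mathfrak S^H))$ gives a torsion theory on ${}_A\mathfrak S^H$.
   Context: Write $\otimes=\otimes_k$. For $\mathcal M\in\mathfrak S$ and a $k$-vector space $V$, $\mathcal M\otimes V\in\mathfrak S$ is defined by letting $\mathcal M\otimes-:k\text{-Mod}\to\mathfrak S$ be the left adjoint of $\mathfrak S(\mathcal M,-)$; we identify $V\otimes\mathcal M$ with $\mathcal M\otimes V$, and $T$ denotes such swap isomorphisms. $H$ is cosemisimple if there is a left integral $\phi:H\to k$ (i.e. a $k$-linear map with $\sum h_1\phi(h_2)=\phi(h)1_H$ for all $h$) such that $\phi(1_H)=1$; then $\phi$ is also a right integral, $\sum\phi(h_1)h_2=\phi(h)1_H$. Fix such $\phi$. ${}_A\mathfrak S^H$ is the category of left-right relative $(A,H)$-Hopf module objects in $\mathfrak S$: triples $(\mathcal M,\mu_{\mathcal M}^A,\Delta_{\mathcal M}^H)$ where $\mu_{\mathcal M}^A:A\otimes\mathcal M\to\mathcal M$ is a (unital, associative) left $A$-module structure on $\mathcal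 M\in\mathfrak S$, $\Delta_{\mathcal M}^H:\mathcal M\to\mathcal M\otimes H$ is a (counital, coassociative) right $H$-comodule structure, and $\Delta^H_{\mathcal M}\circ\mu^A_{\mathcal M}=(\mu^A_{\mathcal M}\otimes\mu_H)\circ(A\otimes T_{H,\mathcal M}\otimes H)\circ(\Delta_A^H\otimes\Delta^H_{\mathcal M})$; morphisms are morphisms in $\mathfrak S$ compatible with the $A$-action and $H$-coaction. For $\mathcal M\in{}_A\mathfrak S^H$, $\mathfrak C^H(\mathcal M)$ is the equalizer in $\mathfrak S$ of $\mathcal M\otimes u_H,\ \Delta^H_{\mathcal M}:\mathcal M\rightrightarrows\mathcal M\otimes H$ ($u_H$ the unit of $H$). $\mathfrak K^H(\mathcal M)$ is the kernel of $\pi_{\mathcal M}^\phi=(\mathcal M\otimes\phi)\circ\Delta_{\mathcal M}^H:\mathcal M\to\mathcal M$, and ${}_A\mathfrak K^H(\mathcal M)$ is the sum of all subobjects $\mathcal M'\subseteq\mathcal M$ in ${}_A\mathfrak S^H$ such that $\mathcal M'\subseteq\mathfrak K^H(\mathcal M)$. A torsion theory on an abelian category $\mathfrak A$ is a pair $(\mathcal T,\mathcal F)$ of (strict) full subcategories such that $\mathfrak A(X,Y)=0$ for all $X\in\mathcal T$, $Y\in\mathcal F$, and every $M\in\mathfrak A$ fits into a short exact sequence $0\to X\to M\to Y\to0$ with $X\in\mathcal T$, $Y\in\mathcal F$. *)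

(* Defs.v *)
From HB Require Import structures.
From mathcomp Require Import all_boot all_order all_algebra.
From mathcomp Require Import generic_quotient boolp.

Set Implicit Arguments.
Unset Strict Implicit.
Unset Printing Implicit Defensive.

Import GRing.Theory.
Local Open Scope ring_scope.
Local Open Scope quotient_scope.

Definition linear_of (k : fieldType) (U V : lmodType k) (f : U -> V)
    (lf : linear f) : {linear U -> V} :=
  HB.pack f (GRing.isLinear.Build k U V *:%R f lf).

Definition bilinear_of (k : fieldType) (U V W : lmodType k) (f : U -> V -> W)
    (lf : forall v, linear (f^~ v)) (fl : forall u, linear (f u)) :
  {bilinear U -> V -> W} :=
  HB.pack f (@bilinear_isBilinear.Build k U V W *:%R *:%R f (lf, fl)).

Section Tensor.
Variables (k : fieldType) (U V : lmodType k).

Definition formal_sum (W : lmodType k) (f : U -> V -> W) (s : seq (U * V)) : W :=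
  \sum_(p <- s) f p.1 p.2.

(* The element of U (x) V denoted by a list of pairs s is the sum of the
   u (x) v for (u, v) in s; two lists denote the same element when no bilinear
   map separates them. *)
Definition tensor_rel (s t : seq (U * V)) : bool :=
  `[< forall (W : lmodType k) (f : {bilinear U -> V -> W}),
        formal_sum f s = formal_sum f t >].

Lemma tensor_rel_refl : reflexive tensor_rel.
Proof. by move=> s; apply/asboolP. Qed.

Lemma tensor_rel_sym : symmetric tensor_rel.
Proof.
by move=> s t; apply/asboolP/asboolP => h W f; rewrite h.
Qed.

Lemma tensor_rel_trans : transitive tensor_rel.
Proof.
by move=> s t u /asboolP h1 /asboolP h2; apply/asboolP => W f; rewrite h1.
Qed.

Canonical tensor_equiv :=
  EquivRel tensor_rel tensor_rel_refl tensor_rel_sym tensor_rel_trans.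

Definition tensor := {eq_quot tensor_equiv}.
HB.instance Definition _ := Choice.on tensor.

Definition tensor_class (s : seq (U * V)) : tensor := \pi_{eq_quot tensor_equiv} s.

Definition tensor_eval (W : lmodType k) (f : U -> V -> W) (t : tensor) : W :=
  formal_sum f (repr t).

Lemma tensor_eval_class (W : lmodType k) (f : {bilinear U -> V -> W}) s :
  tensor_eval f (tensor_class s) = formal_sum f s.
Proof.
rewrite /tensor_eval /tensor_class.
have : repr (\pi_{eq_quot tensor_equiv} s) = s %[mod_eq tensor_equiv].
  by rewrite reprK.
by move/eqmodP/asboolP; apply.
Qed.

Lemma tensor_classK t : tensor_class (repr t) = t.
Proof. exact: reprK. Qed.

Lemma tensor_class_eq s t :
  (forall (W : lmodType k) (f : {bilinear U -> V -> W}),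
     formal_sum f s = formal_sum f t) ->
  tensor_class s = tensor_class t.
Proof. by move=> h; apply/eqmodP/asboolP. Qed.

Lemma tensor_eq (s t : tensor) :
  (forall (W : lmodType k) (f : {bilinear U -> V -> W}),
     tensor_eval f s = tensor_eval f t) ->
  s = t.
Proof.
by move=> h; rewrite -[s]tensor_classK -[t]tensor_classK; apply: tensor_class_eq.
Qed.

Definition tensor_add (s t : tensor) := tensor_class (repr s ++ repr t).
Definition tensor_zero := tensor_class [::].
Definition tensor_scale (c : k) (t : tensor) :=
  tensor_class [seq (c *: p.1, p.2) | p <- repr t].
Definition tensor_opp := tensor_scale (-1).

Lemma tensor_evalD (W : lmodType k) (f : {bilinear U -> V -> W}) s t :
  tensor_eval f (tensor_add s t) = tensor_eval f s + tensor_eval f t.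
Proof. by rewrite tensor_eval_class /formal_sum big_cat. Qed.

Lemma tensor_eval0 (W : lmodType k) (f : {bilinear U -> V -> W}) :
  tensor_eval f tensor_zero = 0.
Proof. by rewrite tensor_eval_class /formal_sum big_nil. Qed.

Lemma tensor_evalZ (W : lmodType k) (f : {bilinear U -> V -> W}) c t :
  tensor_eval f (tensor_scale c t) = c *: tensor_eval f t.
Proof.
rewrite tensor_eval_class /tensor_eval /formal_sum big_map scaler_sumr.
by apply: eq_bigr => p _ /=; rewrite linearZl_LR.
Qed.

Fact tensor_addA : associative tensor_add.
Proof. by move=> r s t; apply: tensor_eq => W f; rewrite !tensor_evalD addrA. Qed.
Fact tensor_addC : commutative tensor_add.
Proof. by move=> r s; apply: tensor_eq => W f; rewrite !tensor_evalD addrC. Qed.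
Fact tensor_add0 : left_id tensor_zero tensor_add.
Proof.
by move=> s; apply: tensor_eq => W f; rewrite tensor_evalD tensor_eval0 add0r.
Qed.
Fact tensor_addN : left_inverse tensor_zero tensor_opp tensor_add.
Proof.
move=> s; apply: tensor_eq => W f.
by rewrite tensor_evalD tensor_eval0 tensor_evalZ scaleN1r addNr.
Qed.

HB.instance Definition _ :=
  GRing.isZmodule.Build tensor tensor_addA tensor_addC tensor_add0 tensor_addN.

Fact tensor_scaleA c d t :
  tensor_scale c (tensor_scale d t) = tensor_scale (c * d) t.
Proof. by apply: tensor_eq => W f; rewrite !tensor_evalZ scalerA. Qed.
Fact tensor_scale1 : left_id 1 tensor_scale.
Proof. by move=> t; apply: tensor_eq => W f; rewrite tensor_evalZ scale1r. Qed.
Fact tensor_scaleDr : right_distributive tensor_scale +%R.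
Proof.
move=> c s t; apply: tensor_eq => W f.
by rewrite !(tensor_evalD, tensor_evalZ) scalerDr.
Qed.
Fact tensor_scaleDl t : {morph tensor_scale^~ t : c d / c + d}.
Proof.
move=> c d; apply: tensor_eq => W f.
by rewrite !(tensor_evalD, tensor_evalZ) scalerDl.
Qed.

HB.instance Definition _ := GRing.Zmodule_isLmodule.Build k tensor
  tensor_scaleA tensor_scale1 tensor_scaleDr tensor_scaleDl.

Definition tens (u : U) (v : V) : tensor := tensor_class [:: (u, v)].

Lemma tensor_eval_tens (W : lmodType k) (f : {bilinear U -> V -> W}) u v :
  tensor_eval f (tens u v) = f u v.
Proof. by rewrite tensor_eval_class /formal_sum big_seq1. Qed.

Fact tens_linear_l v : linear (tens^~ v).
Proof.
move=> c u u'; apply: tensor_eq => W f.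
by rewrite tensor_evalD tensor_evalZ !tensor_eval_tens linearPl.
Qed.
Fact tens_linear_r u : linear (tens u).
Proof.
move=> c v v'; apply: tensor_eq => W f.
by rewrite tensor_evalD tensor_evalZ !tensor_eval_tens linearPr.
Qed.
HB.instance Definition _ :=
  @bilinear_isBilinear.Build k U V tensor *:%R *:%R tens
    (tens_linear_l, tens_linear_r).

Section Lift.
Variables (W : lmodType k) (f : {bilinear U -> V -> W}).

Definition tlift : tensor -> W := tensor_eval f.

Fact tlift_linear : linear tlift.
Proof. by move=> c s t; rewrite /tlift tensor_evalD tensor_evalZ. Qed.
HB.instance Definition _ := GRing.isLinear.Build k tensor W *:%R tlift tlift_linear.

Lemma tlift_tens u v : tlift (tens u v) = f u v.
Proof. exact: tensor_eval_tens. Qed.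
End Lift.

Lemma tliftE (W : lmodType k) (f : {bilinear U -> V -> W}) t :
  tlift f t = \sum_(p <- repr t) f p.1 p.2.
Proof. by []. Qed.

Lemma tensor_sum (t : tensor) : t = \sum_(p <- repr t) tens p.1 p.2.
Proof.
apply: tensor_eq => W f; rewrite -[RHS]/(tlift f _) linear_sum /=.
by apply: eq_bigr => p _; rewrite tlift_tens.
Qed.

Lemma tlift_uniq (W : lmodType k) (g h : {linear tensor -> W}) :
  (forall u v, g (tens u v) = h (tens u v)) -> g =1 h.
Proof.
by move=> e t; rewrite (tensor_sum t) !linear_sum; apply: eq_bigr => p _; apply: e.
Qed.

End Tensor.

Arguments tens {k U V} u v.
Notation "U ⊗k V" := (tensor U V) (at level 40, left associativity).

(* The library's algType excludes the zero algebra, which is a legitimate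
   comodule algebra. *)
Record unital_algebra (k : fieldType) := UnitalAlgebra {
  alg_car :> lmodType k;
  alg_mul : {bilinear alg_car -> alg_car -> alg_car};
  alg_one : alg_car;
  alg_mulA : associative alg_mul;
  alg_mul1l : left_id alg_one alg_mul;
  alg_mul1r : right_id alg_one alg_mul
}.

Arguments alg_mul {k} A : rename.
Arguments alg_one {k} A : rename.

Section Algebras.
Variable k : fieldType.

Section Maps.
Variables U V W X : lmodType k.

Section TMap.
Variables (f : {linear U -> W}) (g : {linear V -> X}).
Fact tmap_linear_l v : linear (fun u => tens (f u) (g v)).
Proof. by move=> c x y; rewrite linearP linearPl. Qed.
Fact tmap_linear_r u : linear (fun v => tens (f u) (g v)).
Proof. by move=> c x y; rewrite linearP linearPr. Qed.
(* f ⊗ g *)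
Definition tmap : {linear U ⊗k V -> W ⊗k X} :=
  tlift (bilinear_of tmap_linear_l tmap_linear_r).
End TMap.

Section Slides.
Variables (f : {linear V -> k^o}) (g : {linear U -> k^o}).
Fact slide_r_linear_l v : linear (fun u : U => f v *: u).
Proof. by move=> c x y; rewrite scalerDr !scalerA mulrC. Qed.
Fact slide_r_linear_r u : linear (fun v => f v *: (u : U)).
Proof. by move=> c x y; rewrite linearP scalerDl scalerA. Qed.
(* U ⊗ f followed by U ⊗ k ≅ U *)
Definition slide_r : {linear U ⊗k V -> U} :=
  tlift (bilinear_of slide_r_linear_l slide_r_linear_r).
Fact slide_l_linear_l v : linear (fun u => g u *: (v : V)).
Proof. by move=> c x y; rewrite linearP scalerDl scalerA. Qed.
Fact slide_l_linear_r u : linear (fun v : V => g u *: v).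
Proof. by move=> c x y; rewrite scalerDr !scalerA mulrC. Qed.
(* g ⊗ V followed by k ⊗ V ≅ V *)
Definition slide_l : {linear U ⊗k V -> V} :=
  tlift (bilinear_of slide_l_linear_l slide_l_linear_r).
End Slides.
End Maps.

Section TAssoc.
Variables U V W : lmodType k.
Section Inner.
Variable w : W.
Fact tassoc_inner_l (v : V) : linear (fun u : U => tens u (tens v w)).
Proof. by move=> c x y; rewrite linearPl. Qed.
Fact tassoc_inner_r (u : U) : linear (fun v : V => tens u (tens v w)).
Proof. by move=> c x y; rewrite linearPl linearPr. Qed.
Definition tassoc_inner : {linear U ⊗k V -> U ⊗k (V ⊗k W)} :=
  tlift (bilinear_of tassoc_inner_l tassoc_inner_r).
End Inner.
Fact tassoc_l w : linear (fun t : U ⊗k V => tassoc_inner w t).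
Proof. by move=> c x y; rewrite linearP. Qed.
Fact tassoc_r t : linear (fun w : W => tassoc_inner w t).
Proof.
move=> c x y; rewrite /tassoc_inner /tmap /= !tliftE scaler_sumr -big_split.
by apply: eq_bigr => p _; rewrite /= !linearPr.
Qed.
(* (u ⊗ v) ⊗ w |-> u ⊗ (v ⊗ w) *)
Definition tassoc : {linear (U ⊗k V) ⊗k W -> U ⊗k (V ⊗k W)} :=
  tlift (bilinear_of tassoc_l tassoc_r).
End TAssoc.

Section TMul.
Variables A B : unital_algebra k.
Section Inner.
Variable t : A ⊗k B.
Fact tmul_inner_l b : linear (fun a => tmap (alg_mul A a) (alg_mul B b) t).
Proof.
move=> c x y; rewrite /tassoc_inner /tmap /= !tliftE scaler_sumr -big_split.
by apply: eq_bigr => p _; rewrite /= !linearPl.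
Qed.
Fact tmul_inner_r a : linear (fun b => tmap (alg_mul A a) (alg_mul B b) t).
Proof.
move=> c x y; rewrite /tassoc_inner /tmap /= !tliftE scaler_sumr -big_split.
by apply: eq_bigr => p _; rewrite /= linearPl linearPr.
Qed.
End Inner.
(* (a ⊗ b) (a' ⊗ b') = a a' ⊗ b b' *)
Definition tmul (s t : A ⊗k B) : A ⊗k B :=
  tlift (bilinear_of (tmul_inner_l t) (tmul_inner_r t)) s.
End TMul.

End Algebras.

Arguments slide_r {k U V} f.
Arguments slide_l {k U V} g.
Arguments tassoc {k U V W}.

(* The antipode is not assumed to be bijective. *)
Record hopf_algebra (k : fieldType) := HopfAlgebra {
  hopf_alg :> unital_algebra k;
  hdelta : {linear hopf_alg -> hopf_alg ⊗k hopf_alg};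
  heps : {linear hopf_alg -> k^o};
  hanti : {linear hopf_alg -> hopf_alg};
  hdelta_coassoc : forall h,
    tassoc (tmap hdelta idfun (hdelta h)) = tmap idfun hdelta (hdelta h);
  hdelta_counit_r : forall h, slide_r heps (hdelta h) = h;
  hdelta_counit_l : forall h, slide_l heps (hdelta h) = h;
  hdelta1 : hdelta (alg_one hopf_alg) = tens (alg_one hopf_alg) (alg_one hopf_alg);
  hdeltaM : forall g h, hdelta (alg_mul hopf_alg g h) = tmul (hdelta g) (hdelta h);
  heps1 : heps (alg_one hopf_alg) = 1;
  hepsM : forall g h, heps (alg_mul hopf_alg g h) = heps g * heps h;
  hanti_l : forall h,
    tlift (alg_mul hopf_alg) (tmap hanti idfun (hdelta h)) = heps h *: alg_one hopf_alg;
  hanti_r : forall h,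
    tlift (alg_mul hopf_alg) (tmap idfun hanti (hdelta h)) = heps h *: alg_one hopf_alg
}.

Arguments hdelta {k} H : rename.
Arguments heps {k} H : rename.
Arguments hanti {k} H : rename.

Definition left_integral (k : fieldType) (H : hopf_algebra k) (phi : {linear H -> k^o}) : Prop :=
  forall h : H, slide_r phi (hdelta H h) = phi h *: alg_one H.

Record comodule_algebra (k : fieldType) (H : hopf_algebra k) := ComoduleAlgebra {
  comod_alg :> unital_algebra k;
  rho : {linear comod_alg -> comod_alg ⊗k H};
  rho_coassoc : forall a,
    tassoc (tmap rho idfun (rho a)) = tmap idfun (hdelta H) (rho a);
  rho_counit : forall a, slide_r (heps H) (rho a) = a;
  rho1 : rho (alg_one comod_alg) = tens (alg_one comod_alg) (alg_one H);
  rhoM : forall a b, rho (alg_mul comod_alg a b) = tmul (rho a) (rho b)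
}.

Arguments rho {k H} A : rename.

(* "Small" means: of the size of the underlying sets of k-vector spaces.  The
   hom-spaces of a k-linear category are small in this sense, and so are the
   index categories of the colimits a Grothendieck category must have. *)
Notation small := Type@{GRing.Lmodule.axioms_.u0} (only parsing).

Record kcat (k : fieldType) := KCat {
  obj :> Type;
  hom : obj -> obj -> lmodType k;
  idm : forall X, hom X X;
  comp : forall X Y Z, {bilinear hom Y Z -> hom X Y -> hom X Z};
  comp1m : forall X Y (f : hom X Y), comp X Y Y (idm Y) f = f;
  compm1 : forall X Y (f : hom X Y), comp X X Y f (idm X) = f;
  compmA : forall X Y Z W (h : hom Z W) (g : hom Y Z) (f : hom X Y),
    comp X Z W h (comp X Y Z g f) = comp X Y W (comp Y Z W h g) f
}.

Arguments hom {k C} X Y : rename.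
Arguments idm {k C} X : rename.
Arguments comp {k C X Y Z} : rename.
Notation "g • f" := (comp g f) (at level 40, left associativity).

Section Abelian.
Variables (k : fieldType) (C : kcat k).
Implicit Types X Y Z : C.

Definition isomorphic X Y : Prop :=
  exists (f : hom X Y) (g : hom Y X), g • f = idm X /\ f • g = idm Y.

Definition is_zero X : Prop :=
  (forall Y (f g : hom X Y), f = g) /\ (forall Y (f g : hom Y X), f = g).

Definition mono X Y (f : hom X Y) : Prop :=
  forall Z (g h : hom Z X), f • g = f • h -> g = h.

Definition epi X Y (f : hom X Y) : Prop :=
  forall Z (g h : hom Y Z), g • f = h • f -> g = h.

Definition is_biproduct X Y P (i : hom X P) (j : hom Y P)
    (p : hom P X) (q : hom P Y) : Prop :=
  [/\ p • i = idm X, q • j = idm Y, p • j = 0, q • i = 0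
    & i • p + j • q = idm P].

Definition is_equalizer X Y (f g : hom X Y) E (e : hom E X) : Prop :=
  f • e = g • e /\
  forall Z (h : hom Z X), f • h = g • h -> exists! l : hom Z E, e • l = h.

Definition is_kernel X Y (f : hom X Y) K (i : hom K X) : Prop :=
  f • i = 0 /\
  forall Z (h : hom Z X), f • h = 0 -> exists! l : hom Z K, i • l = h.

Definition is_cokernel X Y (f : hom X Y) Q (p : hom Y Q) : Prop :=
  p • f = 0 /\
  forall Z (h : hom Y Z), h • f = 0 -> exists! l : hom Q Z, l • p = h.

Definition short_exact X Y Z (f : hom X Y) (g : hom Y Z) : Prop :=
  is_kernel g f /\ is_cokernel f g.

Record abelian : Prop := Abelian {
  ab_zero : exists X, is_zero X;
  ab_biproduct : forall X Y, exists P (i : hom X P) (j : hom Y P)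
    (p : hom P X) (q : hom P Y), is_biproduct i j p q;
  ab_kernel : forall X Y (f : hom X Y), exists K (i : hom K X), is_kernel f i;
  ab_cokernel : forall X Y (f : hom X Y), exists Q (p : hom Y Q),
    is_cokernel f p;
  ab_mono : forall X Y (f : hom X Y), mono f ->
    exists Z (g : hom Y Z), is_kernel g f;
  ab_epi : forall X Y (f : hom X Y), epi f ->
    exists Z (g : hom Z X), is_cokernel g f
}.

(* (S, i) <= (T, j) in the preorder of subobjects of Y *)
Definition factors X Z Y (i : hom X Y) (j : hom Z Y) : Prop :=
  exists l : hom X Z, j • l = i.

(* The sum of a class P of subobjects of Y is the smallest subobject of Y that
   contains them all. *)
Definition is_subobject_sum Y (P : forall X, hom X Y -> Prop)
    S (s : hom S Y) : Prop :=
  [/\ mono s,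
      forall X (i : hom X Y), mono i -> P X i -> factors i s
    & forall Z (j : hom Z Y), mono j ->
        (forall X (i : hom X Y), mono i -> P X i -> factors i j) ->
        factors s j].

(* Full subcategories are given by the predicate of belonging to them. *)
Record torsion_theory (T F : C -> Prop) : Prop := TorsionTheory {
  tt_abelian : abelian;
  tt_strict_torsion : forall X Y, isomorphic X Y -> T X -> T Y;
  tt_strict_torsionfree : forall X Y, isomorphic X Y -> F X -> F Y;
  tt_hom0 : forall X Y (f : hom X Y), T X -> F Y -> f = 0;
  tt_exact : forall M, exists X Y (f : hom X M) (g : hom M Y),
    [/\ T X, F Y & short_exact f g]
}.

Definition generator (G : C) : Prop :=
  forall X Y (f g : hom X Y), f <> g -> exists h : hom G X, f • h <> g • h.

End Abelian.

Record small_cat := SmallCat {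
  sobj :> small;
  shom : sobj -> sobj -> small;
  sid : forall a, shom a a;
  scomp : forall a b c, shom b c -> shom a b -> shom a c;
  scomp1m : forall a b (f : shom a b), scomp (sid b) f = f;
  scompm1 : forall a b (f : shom a b), scomp f (sid a) = f;
  scompA : forall a b c d (h : shom c d) (g : shom b c) (f : shom a b),
    scomp h (scomp g f) = scomp (scomp h g) f
}.

Definition filtered (J : small_cat) : Prop :=
  [/\ exists a : J, True,
      forall a b : J, exists c (f : shom a c) (g : shom b c), True
    & forall (a b : J) (f g : shom a b),
        exists c (h : shom b c), scomp h f = scomp h g].

Section Grothendieck.
Variables (k : fieldType) (C : kcat k).

Record diagram (J : small_cat) := Diagram {
  dobj :> J -> C;
  dmap : forall a b, shom a b -> hom (dobj a) (dobj b);
  dmap1 : forall a, dmap (sid a) = idm (dobj a);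
  dmapM : forall a b c (g : shom b c) (f : shom a b),
    dmap (scomp g f) = dmap g • dmap f
}.

Section Colimits.
Variable J : small_cat.
Implicit Types D E F : diagram J.

Definition is_cocone D X (c : forall a, hom (D a) X) : Prop :=
  forall a b (f : shom a b), c b • dmap D f = c a.

Definition is_colimit D X (c : forall a, hom (D a) X) : Prop :=
  is_cocone c /\
  forall Y (d : forall a, hom (D a) Y), is_cocone d ->
    exists! h : hom X Y, forall a, h • c a = d a.

Definition natural D E (alpha : forall a, hom (D a) (E a)) : Prop :=
  forall a b (f : shom a b), alpha b • dmap D f = dmap E f • alpha a.

Definition exact_colimits : Prop :=
  forall D E F (alpha : forall a, hom (D a) (E a))
    (beta : forall a, hom (E a) (F a)),
  natural alpha -> natural beta ->
  (forall a, short_exact (alpha a) (beta a)) ->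
  forall X Y Z (c : forall a, hom (D a) X) (d : forall a, hom (E a) Y)
    (e : forall a, hom (F a) Z),
  is_colimit c -> is_colimit d -> is_colimit e ->
  forall (f : hom X Y) (g : hom Y Z),
  (forall a, f • c a = d a • alpha a) -> (forall a, g • d a = e a • beta a) ->
  short_exact f g.

End Colimits.

Record grothendieck : Prop := Grothendieck {
  gr_abelian : abelian C;
  gr_cocomplete : forall (J : small_cat) (D : diagram J),
    exists X (c : forall a, hom (D a) X), is_colimit c;
  gr_ab5 : forall J : small_cat, filtered J -> exact_colimits J;
  gr_generator : exists G : C, generator G
}.

End Grothendieck.

Record grothendieck_cat (k : fieldType) := GrothendieckCat {
  gr_cat :> kcat k;
  gr_catP : grothendieck gr_cat
}.

Section CopowerExistence.
Variables (k : fieldType) (S : grothendieck_cat k) (M : S) (V : lmodType k).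

Record copower := Copower {
  cp_obj : S;
  cp_in : {linear V -> hom M cp_obj};
  cp_univ : forall N (f : {linear V -> hom M N}),
    exists! g : hom cp_obj N, forall v, g • cp_in v = f v
}.

Definition discrete (I : small) : small_cat.
Proof.
exists I (fun a b => a = b) (fun a => erefl) (fun a b c g f => etrans f g).
- by move=> a b [].
- by move=> a b [].
- by move=> a b c d [] [] [].
Defined.

Definition constant_diagram (I : small) : diagram S (discrete I).
Proof.
exists (fun _ => M) (fun _ _ _ => idm M).
- by [].
- by move=> *; rewrite comp1m.
Defined.

Lemma copower_exists : inhabited copower.
Proof.
have coprod (I : small) : exists X (c : I -> hom M X), forall Y (d : I -> hom M Y),
    exists! h : hom X Y, forall i, h • c i = d i.
  have [X [c [_ cP]]] := gr_cocomplete (gr_catP S) (constant_diagram I).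
  exists X, c => Y d; apply: (cP Y d).
  by move=> a b f; rewrite /= compm1; case: b / f.
have [X [i iP]] := coprod V.
have [R [j jP]] := coprod (k * V * V)%type.
have [r [rP _]] :=
  jP X (fun p => i (p.1.1 *: p.1.2 + p.2) - (p.1.1 *: i p.1.2 + i p.2)).
have [Q [q [qr qP]]] := ab_cokernel (gr_abelian (gr_catP S)) r.
have lin : linear (fun v => q • i v).
  move=> c v w; apply/eqP; rewrite -subr_eq0 -linearPr -linearBr.
  by rewrite -(rP (c, v, w)) compmA qr linear0l.
constructor; exists Q (linear_of lin) => N f.
have [g [gP guniq]] := iP N f.
have gr : g • r = 0.
  have [z [zP zuniq]] := jP N (fun=> 0).
  have <- : z = 0 by apply: zuniq => p; rewrite linear0l.
  symmetry; apply: zuniq => -[[c v] w] /=.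
  by rewrite -compmA rP linearBr linearPr !gP linearP subrr.
have [h [hP huniq]] := qP N g gr.
exists h; split=> [v|h' h'P]; first by rewrite /= compmA hP gP.
by apply: huniq; symmetry; apply: guniq => v; rewrite -compmA -h'P.
Qed.

Definition the_copower : copower :=
  sval (cid (let: inhabits x := copower_exists in ex_intro (fun=> True) x I)).

End CopowerExistence.

Definition cobj (k : fieldType) (S : grothendieck_cat k) (M : S)
  (V : lmodType k) : S := cp_obj (the_copower M V).
Notation "M ⊗ V" := (cobj M V) (at level 40, left associativity).

Section Copower.
Variables (k : fieldType) (S : grothendieck_cat k).

(* The unit of the adjunction: cin v is m |-> m ⊗ v. *)
Definition cin (M : S) (V : lmodType k) : {linear V -> hom M (M ⊗ V)} :=
  cp_in (the_copower M V).

(* The morphism m ⊗ v |-> f v m *)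
Definition clift (M N : S) (V : lmodType k) (f : {linear V -> hom M N}) :
  hom (M ⊗ V) N := sval (cid (cp_univ (the_copower M V) f)).

Lemma clift_in (M N : S) (V : lmodType k) (f : {linear V -> hom M N}) v :
  clift f • cin M V v = f v.
Proof. by rewrite /clift; case: cid => g /= [gP _]; apply: gP. Qed.

Lemma cin_ext (M N : S) (V : lmodType k) (g h : hom (M ⊗ V) N) :
  (forall v, g • cin M V v = h • cin M V v) -> g = h.
Proof.
move=> e; have lin : linear (fun v => h • cin M V v).
  by move=> c x y; rewrite linearP linearPr.
have [l [_ luniq]] := cp_univ (the_copower M V) (linear_of lin).
by rewrite -(luniq g) // -(luniq h).
Qed.

Section MapObj.
Variables (M N : S) (f : hom M N) (V : lmodType k).
Fact cmap_obj_linear : linear (fun v => cin N V v • f).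
Proof. by move=> c x y; rewrite linearP linearPl. Qed.
(* f ⊗ V *)
Definition cmap_obj : hom (M ⊗ V) (N ⊗ V) := clift (linear_of cmap_obj_linear).
End MapObj.

Section MapVect.
Variables (M : S) (V W : lmodType k) (g : {linear V -> W}).
(* M ⊗ g *)
Definition cmap_vect : hom (M ⊗ V) (M ⊗ W) := clift (cin M W \o g).
End MapVect.

Section Unitor.
Variable M : S.
Fact cunit_linear : linear (fun c : k^o => c *: idm M).
Proof. by move=> c x y; rewrite scalerDl scalerA. Qed.
(* m ⊗ c |-> c m *)
Definition cunit : hom (M ⊗ k^o) M := clift (linear_of cunit_linear).
End Unitor.

Section Associators.
Variables (M : S) (V W : lmodType k).
Fact cassoc_l w : linear (fun v => cin (M ⊗ V) W w • cin M V v).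
Proof. by move=> c x y; rewrite linearP linearPr. Qed.
Fact cassoc_r v : linear (fun w => cin (M ⊗ V) W w • cin M V v).
Proof. by move=> c x y; rewrite linearP linearPl. Qed.
(* m ⊗ (v ⊗ w) |-> (m ⊗ v) ⊗ w *)
Definition cassoc : hom (M ⊗ (V ⊗k W)) ((M ⊗ V) ⊗ W) :=
  clift (tlift (bilinear_of cassoc_l cassoc_r)).

Fact cassoc_swap_l w : linear (fun v => cin (M ⊗ W) V v • cin M W w).
Proof. by move=> c x y; rewrite linearP linearPl. Qed.
Fact cassoc_swap_r v : linear (fun w => cin (M ⊗ W) V v • cin M W w).
Proof. by move=> c x y; rewrite linearP linearPr. Qed.
(* m ⊗ (v ⊗ w) |-> (m ⊗ w) ⊗ v, that is (v ⊗ w) ⊗ m |-> v ⊗ (w ⊗ m) when the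
   vector spaces are written on the left *)
Definition cassoc_swap : hom (M ⊗ (V ⊗k W)) ((M ⊗ W) ⊗ V) :=
  clift (tlift (bilinear_of cassoc_swap_l cassoc_swap_r)).
End Associators.

Section Middle.
Variables (M : S) (V A W : lmodType k).
Section Inner.
Variables (a : A) (w : W).
Fact cmiddle_linear :
  linear (fun v => cin (M ⊗ A) (W ⊗k V) (tens w v) • cin M A a).
Proof. by move=> c x y; rewrite linearPr linearP linearPl. Qed.
Definition cmiddle_inner : hom (M ⊗ V) ((M ⊗ A) ⊗ (W ⊗k V)) :=
  clift (linear_of cmiddle_linear).
End Inner.
Fact cmiddle_l w : linear (fun a => cmiddle_inner a w).
Proof.
move=> c x y; apply: cin_ext => v.
by rewrite linearPl !clift_in /= linearP linearPr.
Qed.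
Fact cmiddle_r a : linear (fun w => cmiddle_inner a w).
Proof.
move=> c x y; apply: cin_ext => v.
by rewrite linearPl !clift_in /= linearPl linearP linearPl.
Qed.
(* (m ⊗ v) ⊗ (a ⊗ w) |-> (m ⊗ a) ⊗ (w ⊗ v), that is
   (a ⊗ w) ⊗ (m ⊗ v) |-> (a ⊗ m) ⊗ (w ⊗ v): the exchange of w and m *)
Definition cmiddle : hom ((M ⊗ V) ⊗ (A ⊗k W)) ((M ⊗ A) ⊗ (W ⊗k V)) :=
  clift (tlift (bilinear_of cmiddle_l cmiddle_r)).
End Middle.

End Copower.

Arguments cmap_vect {k S} M {V W} g.

Section HopfModules.
Variables (k : fieldType) (S : grothendieck_cat k) (H : hopf_algebra k)
  (A : comodule_algebra H).

(* Vector spaces are always written on the right: A ⊗ M is identified with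
   M ⊗ A, so that act sends m ⊗ a to a m. *)
Record hopf_mod := HopfMod {
  hm_obj :> S;
  act : hom (hm_obj ⊗ A) hm_obj;
  coact : hom hm_obj (hm_obj ⊗ H);
  act1 : act • cin hm_obj A (alg_one A) = idm hm_obj;
  actM : act • cmap_vect hm_obj (tlift (alg_mul A)) =
         act • cmap_obj act A • cassoc_swap hm_obj A A;
  coact_counit : cunit hm_obj • cmap_vect hm_obj (heps H) • coact = idm hm_obj;
  coact_coassoc : cassoc hm_obj H H • cmap_vect hm_obj (hdelta H) • coact =
                  cmap_obj coact H • coact;
  coact_act : coact • act =
    (cmap_vect hm_obj (tlift (alg_mul H)) • cmap_obj act (H ⊗k H))
    • cmiddle hm_obj H A H
    • (cmap_obj coact (A ⊗k H) • cmap_vect hm_obj (rho A))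
}.

Definition is_hopf_hom (M N : hopf_mod) (f : hom M N) : Prop :=
  f • act M = act N • cmap_obj f A /\ coact N • f = cmap_obj f H • coact M.

Record hopf_hom (M N : hopf_mod) := HopfHom {
  hh_val : hom M N;
  hh_subproof : `[< is_hopf_hom hh_val >]
}.

Section HopfHom.
Variables M N : hopf_mod.
HB.instance Definition _ := [isSub for @hh_val M N].
HB.instance Definition _ := [Choice of hopf_hom M N by <:].

Lemma hh_valP (f : hopf_hom M N) : is_hopf_hom (hh_val f).
Proof. exact/asboolP/(hh_subproof f). Qed.

Fact cmap_obj_is_linear (V : lmodType k) :
  linear (fun f : hom M N => cmap_obj f V).
Proof.
move=> c f g; apply: cin_ext => v.
by rewrite linearPl !clift_in /= linearPr.
Qed.

Fact hopf_hom_submod_closed :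
  submod_closed (fun f : hom M N => `[< is_hopf_hom f >]).
Proof.
pose L V := linear_of (cmap_obj_is_linear V).
split=> [|c f g /asboolP[fa fc] /asboolP[ga gc]]; apply/asboolP.
  have L0 V : cmap_obj (0 : hom M N) V = 0 by exact: (linear0 (L V)).
  by split; rewrite L0 linear0l linear0r.
by split; rewrite !cmap_obj_is_linear linearPl linearPr ?fa ?ga ?fc ?gc.
Qed.

HB.instance Definition _ := GRing.SubChoice_isSubLmodule.Build k (hom M N) _
  (hopf_hom M N) (GRing.submod_closed_semi hopf_hom_submod_closed).

End HopfHom.

Fact hopf_id_subproof (M : hopf_mod) : `[< is_hopf_hom (idm M) >].
Proof.
have e V : cmap_obj (idm M) V = idm (M ⊗ V).
  by apply: cin_ext => v; rewrite clift_in /= compm1 comp1m.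
by apply/asboolP; split; rewrite e compm1 comp1m.
Qed.

Fact hopf_comp_subproof (M N P : hopf_mod) (g : hopf_hom N P)
    (f : hopf_hom M N) : `[< is_hopf_hom (hh_val g • hh_val f) >].
Proof.
have e V : cmap_obj (hh_val g • hh_val f) V =
    cmap_obj (hh_val g) V • cmap_obj (hh_val f) V.
  apply: cin_ext => v.
  by rewrite -compmA !clift_in /= !compmA clift_in.
have [fa fc] := hh_valP f; have [ga gc] := hh_valP g.
apply/asboolP; split; rewrite e.
  by rewrite -compmA fa !compmA ga.
by rewrite compmA gc -compmA fc compmA.
Qed.

Definition hopf_id (M : hopf_mod) : hopf_hom M M :=
  HopfHom (hopf_id_subproof M).

Definition hopf_comp_fun (M N P : hopf_mod) (g : hopf_hom N P)
  (f : hopf_hom M N) : hopf_hom M P := HopfHom (hopf_comp_subproof g f).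

Fact hopf_comp_linear_l M N P (f : hopf_hom M N) :
  linear (fun g : hopf_hom N P => hopf_comp_fun g f).
Proof. by move=> c x y; apply: val_inj; exact: linearPl. Qed.
Fact hopf_comp_linear_r M N P (g : hopf_hom N P) :
  linear (fun f : hopf_hom M N => hopf_comp_fun g f).
Proof. by move=> c x y; apply: val_inj; exact: linearPr. Qed.

Definition hopf_comp M N P :
  {bilinear hopf_hom N P -> hopf_hom M N -> hopf_hom M P} :=
  bilinear_of (@hopf_comp_linear_l M N P) (@hopf_comp_linear_r M N P).

(* The category of left-right relative (A, H)-Hopf module objects in S *)
Definition hopf_cat : kcat k.
Proof.
refine (@KCat k hopf_mod (fun M N => hopf_hom M N) hopf_id hopf_comp _ _ _).
- by move=> M N f; apply: val_inj; rewrite /= comp1m.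
- by move=> M N f; apply: val_inj; rewrite /= compm1.
- by move=> M N P Q h g f; apply: val_inj; rewrite /= compmA.
Defined.

End HopfModules.

Section KernelsOfS.
Variables (k : fieldType) (S : grothendieck_cat k) (X Y : S) (f g : hom X Y).

Lemma equalizer_exists : exists E (e : hom E X), is_equalizer f g e.
Proof.
have [E [e [e0 eP]]] := ab_kernel (gr_abelian (gr_catP S)) (f - g).
exists E, e; split=> [|Z h fh].
  by apply/eqP; rewrite -subr_eq0 -linearBl e0.
by apply: eP; rewrite linearBl fh subrr.
Qed.

Definition equalizer : S := sval (cid equalizer_exists).
Definition equalizer_in : hom equalizer X :=
  sval (cid (svalP (cid equalizer_exists))).
Lemma equalizerP : is_equalizer f g equalizer_in.
Proof. exact: svalP (cid (svalP (cid equalizer_exists))). Qed.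

Definition kernel : S := sval (cid (ab_kernel (gr_abelian (gr_catP S)) f)).
Definition kernel_in : hom kernel X :=
  sval (cid (svalP (cid (ab_kernel (gr_abelian (gr_catP S)) f)))).
Lemma kernelP : is_kernel f kernel_in.
Proof.
exact: svalP (cid (svalP (cid (ab_kernel (gr_abelian (gr_catP S)) f)))).
Qed.
End KernelsOfS.

Section Coinvariants.
Variables (k : fieldType) (S : grothendieck_cat k) (H : hopf_algebra k)
  (A : comodule_algebra H) (phi : {linear H -> k^o}).
Implicit Types M : hopf_mod S A.

(* cin M H 1 is m |-> m ⊗ 1, that is M ⊗ u_H *)
Definition coinvariants M : S := equalizer (cin M H (alg_one H)) (coact M).

Definition pi_phi M : hom M M := cunit M • cmap_vect M phi • coact M.

Definition in_KH M (M' : hopf_cat S A) (i : @hom k (hopf_cat S A) M' M) : Prop :=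
  factors (hh_val i) (kernel_in (pi_phi M)).

Definition is_AKH M (K : hopf_cat S A) (s : @hom k (hopf_cat S A) K M) : Prop :=
  is_subobject_sum (@in_KH M) s.

Definition torsion_class (M : hopf_cat S A) : Prop := is_zero (coinvariants M).

(* The sum of the subobjects of M contained in K^H(M) exists and is zero. *)
Definition torsionfree_class (M : hopf_cat S A) : Prop :=
  exists (K : hopf_cat S A) (s : hom K M), is_AKH s /\ is_zero K.

End Coinvariants.

(* Main.v *)
Require Import Defs.
From HB Require Import structures.
From mathcomp Require Import all_boot all_order all_algebra.
From mathcomp Require Import boolp.
(* Repeated because all_algebra shadows [hom]. *)
Require Import Defs.

(** The map pi = (M ⊗ phi) o Delta is a natural idempotent of S with image
    C^H(M), so C^H(M) = 0 iff pi_M = 0, and a Hopf submodule of M lies in K^H(M)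
    iff it is torsion.  Hence the torsion class is closed under subobjects,
    quotients and extensions, and {}_A K^H(M) is the largest torsion subobject
    of M; it exists because the sum in S of a class of Hopf submodules is again
    a Hopf submodule.  That {}_A S^H is abelian rests on the exactness of - ⊗ V: V is a
    filtered colimit of the spaces k^n, for which - ⊗ k^n is a finite direct
    sum, so AB5 applies. *)

Import GRing.Theory.
Local Open Scope ring_scope.

Set Implicit Arguments.
Unset Strict Implicit.
Unset Printing Implicit Defensive.

(** * Kernels and monomorphisms in abelian categories *)

Section KCat.
Variables (k : fieldType) (C : kcat k).
Implicit Types X Y Z : C.

Lemma monoP X Y (f : hom X Y) :
  mono f <-> forall Z (x : hom Z X), f • x = 0 -> x = 0.
Proof.
split=> [fm Z x fx|fm Z g h e]; first by apply: fm; rewrite fx linear0r.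
by apply/eqP; rewrite -subr_eq0; apply/eqP/fm; rewrite linearBr e subrr.
Qed.

Lemma epiP X Y (f : hom X Y) :
  epi f <-> forall Z (x : hom Y Z), x • f = 0 -> x = 0.
Proof.
split=> [fm Z x fx|fm Z g h e]; first by apply: fm; rewrite fx linear0l.
by apply/eqP; rewrite -subr_eq0; apply/eqP/fm; rewrite linearBl e subrr.
Qed.

Lemma is_zeroP X : is_zero X <-> idm X = 0.
Proof.
split=> [[h _]|h]; first exact: h.
by split=> Y f g; [rewrite -[f]compm1 -[g]compm1 h !linear0r
                 | rewrite -[f]comp1m -[g]comp1m h !linear0l].
Qed.

Lemma mono_comp X Y Z (g : hom Y Z) (f : hom X Y) :
  mono g -> mono f -> mono (g • f).
Proof. by move=> gm fm W x y; rewrite -!compmA => /gm/fm. Qed.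

Lemma epi_comp X Y Z (g : hom Y Z) (f : hom X Y) :
  epi g -> epi f -> epi (g • f).
Proof. by move=> gm fm W x y; rewrite !compmA => /fm/gm. Qed.

Lemma split_mono X Y (g : hom Y X) (f : hom X Y) : g • f = idm X -> mono f.
Proof. by move=> gf W x y e; rewrite -[x]comp1m -[y]comp1m -gf -!compmA e. Qed.

Lemma kernel_mono X Y (f : hom X Y) K (i : hom K X) : is_kernel f i -> mono i.
Proof.
move=> [fi u] Z g h e; have [|l [_ lu]] := u Z (i • g).
  by rewrite compmA fi linear0l.
by rewrite -(lu g) // -(lu h).
Qed.

Lemma cokernel_epi X Y (f : hom X Y) Q (p : hom Y Q) : is_cokernel f p -> epi p.
Proof.
move=> [fi u] Z g h e; have [|l [_ lu]] := u Z (g • p).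
  by rewrite -compmA fi linear0r.
by rewrite -(lu g) // -(lu h).
Qed.

Lemma kernel_lift X Y (f : hom X Y) K (i : hom K X) Z (h : hom Z X) :
  is_kernel f i -> f • h = 0 -> exists l, i • l = h.
Proof. by move=> [_ u] /u[l [lP _]]; exists l. Qed.

Lemma cokernel_desc X Y (f : hom X Y) Q (p : hom Y Q) Z (h : hom Y Z) :
  is_cokernel f p -> h • f = 0 -> exists l, l • p = h.
Proof. by move=> [_ u] /u[l [lP _]]; exists l. Qed.

Lemma is_kernelI X Y (f : hom X Y) K (i : hom K X) :
  mono i -> f • i = 0 ->
  (forall Z (h : hom Z X), f • h = 0 -> exists l, i • l = h) -> is_kernel f i.
Proof.
move=> im fi u; split=> // Z h /u[l lP]; exists l; split=> // l' l'P.
by apply: im; rewrite lP.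
Qed.

Lemma is_cokernelI X Y (f : hom X Y) Q (p : hom Y Q) :
  epi p -> p • f = 0 ->
  (forall Z (h : hom Y Z), h • f = 0 -> exists l, l • p = h) -> is_cokernel f p.
Proof.
move=> im fi u; split=> // Z h /u[l lP]; exists l; split=> // l' l'P.
by apply: im; rewrite lP.
Qed.

Lemma kernel_mono_comp X Y Z (m : hom Y Z) (f : hom X Y) K (i : hom K X) :
  mono m -> is_kernel f i -> is_kernel (m • f) i.
Proof.
move=> mm iP; apply: is_kernelI; first exact: kernel_mono iP.
  by rewrite -compmA iP.1 linear0r.
move=> W h; rewrite -compmA => e; apply: (kernel_lift iP).
by apply: mm; rewrite e linear0r.
Qed.

Lemma mono_kernel0 X Y (f : hom X Y) K (i : hom K X) :
  is_kernel f i -> i = 0 -> mono f.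
Proof.
move=> iP i0; apply/monoP => Z x /(kernel_lift iP)[l <-].
by rewrite i0 linear0l.
Qed.

Lemma epi_cokernel0 X Y (f : hom X Y) Q (p : hom Y Q) :
  is_cokernel f p -> p = 0 -> epi f.
Proof.
move=> pP p0; apply/epiP => Z x /(cokernel_desc pP)[l <-].
by rewrite p0 linear0r.
Qed.

(** A decomposition of the identity survives additive functors, so this serves both for a biproduct
    and for its images under - ⊗ V. *)
Lemma joint_mono2 X Y W Z (u : hom Y X) (v : hom X Y) (u' : hom W X)
    (v' : hom X W) (x y : hom Z X) :
  u • v + u' • v' = idm X -> v • x = v • y -> v' • x = v' • y -> x = y.
Proof.
move=> e e1 e2; rewrite -[x]comp1m -[y]comp1m -e !linearDl -!compmA.
by rewrite e1 e2.
Qed.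

Hypothesis Cab : abelian C.

Lemma mono_is_kernel X Y (f : hom X Y) Q (p : hom Y Q) :
  mono f -> is_cokernel f p -> is_kernel p f.
Proof.
move=> fm pP; apply: is_kernelI => //; first exact: pP.1.
move=> Z h ph; have [W [g gP]] := ab_mono Cab fm.
have [r rp] := cokernel_desc pP gP.1.
by apply: (kernel_lift gP); rewrite -rp -compmA ph linear0r.
Qed.

Lemma epi_is_cokernel X Y (f : hom X Y) K (i : hom K X) :
  epi f -> is_kernel f i -> is_cokernel i f.
Proof.
move=> fe iP; apply: is_cokernelI => //; first exact: iP.1.
move=> Z h hi; have [W [g gP]] := ab_epi Cab fe.
have [r ir] := kernel_lift iP gP.1.
by apply: (cokernel_desc gP); rewrite -ir compmA hi linear0l.
Qed.

(** If [m • x = 0], then [m] factors through the cokernel [q] of [x]. The epi [q • e] is a cokernel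
    of some [z]; then [f • z = 0], hence [e • z = 0], and [e] factors through [q • e]. So [q] is a
    split mono, and [q • x = 0] gives [x = 0]. *)
Lemma coimage_mono X Y (f : hom X Y) K (i : hom K X) I (e : hom X I)
    (m : hom I Y) :
  is_kernel f i -> is_cokernel i e -> m • e = f -> mono m.
Proof.
move=> iP eP me; apply/monoP => W x mx.
have [Q [q qP]] := ab_cokernel Cab x.
have [m' m'q] := cokernel_desc qP mx.
have qe : epi (q • e).
  by apply: epi_comp; [exact: cokernel_epi qP|exact: cokernel_epi eP].
have [V [z zP]] := ab_epi Cab qe.
have [|z' iz] := kernel_lift (h := z) iP.
  by rewrite -me -m'q -!compmA (compmA q) zP.1 linear0r.
have [|r rq] := cokernel_desc (h := e) zP.
  by rewrite -iz compmA eP.1 linear0l.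
have rq1 : r • q = idm I.
  by apply: (cokernel_epi eP); rewrite -compmA rq comp1m.
by apply: (split_mono rq1); rewrite qP.1 linear0r.
Qed.

Lemma coimage_factorization X Y (f : hom X Y) K (i : hom K X) :
  is_kernel f i -> exists I (e : hom X I) (m : hom I Y),
    [/\ is_cokernel i e, mono m & m • e = f].
Proof.
move=> iP; have [I [e eP]] := ab_cokernel Cab i.
have [m me] := cokernel_desc eP iP.1.
by exists I, e, m; split=> //; exact: (coimage_mono iP eP me).
Qed.

End KCat.

(** * Exactness of the copower functors *)

Section TensorFunctor.
Variables (k : fieldType) (S : grothendieck_cat k).
Implicit Types (M N P : S) (U V W : lmodType k).

Lemma cmap_obj_in M N (f : hom M N) V v :
  cmap_obj f V • cin M V v = cin N V v • f.
Proof. exact: clift_in. Qed.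

Lemma cmap_vect_in M V W (g : {linear V -> W}) v :
  cmap_vect M g • cin M V v = cin M W (g v).
Proof. exact: clift_in. Qed.

Lemma cmap_obj_comp M N P (g : hom N P) (f : hom M N) V :
  cmap_obj (g • f) V = cmap_obj g V • cmap_obj f V.
Proof.
by apply: cin_ext => v; rewrite -compmA !cmap_obj_in !compmA cmap_obj_in.
Qed.

Lemma cmap_obj_id M V : cmap_obj (idm M) V = idm (M ⊗ V).
Proof. by apply: cin_ext => v; rewrite cmap_obj_in compm1 comp1m. Qed.

Lemma cmap_objD M N (f g : hom M N) V :
  cmap_obj (f + g) V = cmap_obj f V + cmap_obj g V.
Proof.
by apply: cin_ext => v; rewrite linearDl !cmap_obj_in linearDr.
Qed.

Lemma cmap_obj0 M N V : cmap_obj (0 : hom M N) V = 0.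
Proof. by apply: cin_ext => v; rewrite cmap_obj_in linear0r linear0l. Qed.

Lemma cmap_vectC M N (f : hom M N) V W (g : {linear V -> W}) :
  cmap_obj f W • cmap_vect M g = cmap_vect N g • cmap_obj f V.
Proof.
apply: cin_ext => v.
by rewrite -!compmA cmap_vect_in !cmap_obj_in compmA cmap_vect_in.
Qed.

(** A morphism out of M ⊗ V is a linear family of morphisms out of M, so the factorization is found
    vector by vector; it is linear in the vector because [p] is epi. *)
Lemma cmap_obj_cokernel M N (f : hom M N) Q (p : hom N Q) V :
  is_cokernel f p -> is_cokernel (cmap_obj f V) (cmap_obj p V).
Proof.
move=> pP; have pe := cokernel_epi pP; apply: is_cokernelI.
- move=> Z g h e; apply: cin_ext => v; apply: pe.
  by rewrite -!compmA -cmap_obj_in !compmA e.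
- by rewrite -cmap_obj_comp pP.1 cmap_obj0.
move=> Z h hf.
have lP v : exists l, l • p = h • cin N V v.
  apply: (cokernel_desc pP).
  by rewrite -compmA -cmap_obj_in compmA hf linear0l.
pose l v := sval (cid (lP v)).
have lE v : l v • p = h • cin N V v by exact: svalP (cid (lP v)).
have llin : linear l.
  by move=> c x y; apply: pe; rewrite linearPl !lE linearP linearPr.
exists (clift (linear_of llin)); apply: cin_ext => v.
by rewrite -compmA cmap_obj_in compmA clift_in lE.
Qed.

Lemma cmap_obj_epi M N (f : hom M N) V : epi f -> epi (cmap_obj f V).
Proof.
move=> fe; apply/epiP => Z x xf; apply: cin_ext => v; apply: fe.
by rewrite !linear0l -compmA -cmap_obj_in compmA xf linear0l.
Qed.

(** * Tensoring with k^n as an n-fold direct sum *)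

Section FiniteDimensional.
Variable n : nat.

Fact ccoord_linear M (i : 'I_n) : linear (fun x : 'rV[k]_n => x 0 i *: idm M).
Proof. by move=> c x y; rewrite !mxE scalerDl scalerA. Qed.
(** The i-th projection of M ⊗ k^n ≅ M^n; the matching injection is [cin] at [delta_mx 0 i]. *)
Definition ccoord M i : hom (M ⊗ 'rV[k]_n) M :=
  clift (linear_of (@ccoord_linear M i)).

Lemma ccoord_in M i x : ccoord M i • cin M 'rV[k]_n x = x 0 i *: idm M.
Proof. exact: clift_in. Qed.

Lemma ccoord_nat M N (f : hom M N) i :
  ccoord N i • cmap_obj f 'rV[k]_n = f • ccoord M i.
Proof.
apply: cin_ext => x; rewrite -!compmA ccoord_in cmap_obj_in compmA ccoord_in.
by rewrite linearZl_LR linearZr_LR comp1m compm1.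
Qed.

Lemma ccoord_sum M :
  \sum_i cin M 'rV[k]_n (delta_mx 0 i) • ccoord M i = idm _.
Proof.
apply: cin_ext => x; rewrite linear_sumlz /= comp1m.
rewrite {2}[x]row_sum_delta linear_sum /=; apply: eq_bigr => i _.
by rewrite -compmA ccoord_in linearZr_LR compm1 linearZ.
Qed.

Lemma ccoord_ext M Z (g h : hom Z (M ⊗ 'rV[k]_n)) :
  (forall i, ccoord M i • g = ccoord M i • h) -> g = h.
Proof.
move=> e; rewrite -[g]comp1m -[h]comp1m -ccoord_sum !linear_sumlz.
by apply: eq_bigr => i _; rewrite -!compmA e.
Qed.

(** Kernels of direct sums are computed coordinatewise: the lift is reassembled from the lifts of
    the coordinates. *)
Lemma cmap_obj_kernel_fin M N (f : hom M N) K (i : hom K M) :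
  is_kernel f i -> is_kernel (cmap_obj f 'rV[k]_n) (cmap_obj i 'rV[k]_n).
Proof.
move=> iP; have im := kernel_mono iP; apply: is_kernelI.
- move=> Z g h e; apply: ccoord_ext => j; apply: im.
  by rewrite !compmA -!ccoord_nat -!compmA e.
- by rewrite -cmap_obj_comp iP.1 cmap_obj0.
move=> Z h fh.
have lP j : exists l, i • l = ccoord M j • h.
  apply: (kernel_lift iP).
  by rewrite compmA -ccoord_nat -compmA fh linear0r.
pose l j := sval (cid (lP j)).
have lE j : i • l j = ccoord M j • h by exact: svalP (cid (lP j)).
exists (\sum_j cin K 'rV[k]_n (delta_mx 0 j) • l j).
rewrite linear_sumr -[RHS]comp1m -ccoord_sum linear_sumlz.
apply: eq_bigr => j _.
by rewrite compmA cmap_obj_in -compmA lE compmA.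
Qed.

End FiniteDimensional.

End TensorFunctor.

(** * Vector spaces as filtered colimits of the spaces k^n, and exactness of - ⊗ V *)

Section FreeApproximations.
Variables (k : fieldType) (V : lmodType k).

(** Objects of the comma category of the spaces k^n over V. Allowing all linear maps, injective or
    not, avoids a choice of bases, and coordinate spaces keep the category small. *)
Record free_over := FreeOver {
  fo_rank : nat;
  fo_map : {linear 'rV[k]_fo_rank -> V}
}.

Record free_over_hom (a b : free_over) := FreeOverHom {
  fh_mx : 'M[k]_(fo_rank a, fo_rank b);
  fh_map : forall x, fo_map b (x *m fh_mx) = fo_map a x
}.

Lemma free_over_hom_eq a b (f g : free_over_hom a b) :
  fh_mx f = fh_mx g -> f = g.
Proof.
case: f g => [f fP] [g gP] /= e; case: g / e gP => gP.
by rewrite (Prop_irrelevance fP gP).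
Qed.

Fact free_over_id_subproof a x : fo_map a (x *m 1%:M) = fo_map a x.
Proof. by rewrite mulmx1. Qed.

Fact free_over_comp_subproof a b c (g : free_over_hom b c)
  (f : free_over_hom a b) x : fo_map c (x *m (fh_mx f *m fh_mx g)) = fo_map a x.
Proof. by rewrite mulmxA !fh_map. Qed.

Definition free_over_cat : small_cat.
Proof.
refine (@SmallCat free_over free_over_hom
  (fun a => FreeOverHom (@free_over_id_subproof a))
  (fun a b c g f => FreeOverHom (free_over_comp_subproof g f)) _ _ _).
- by move=> a b f; apply: free_over_hom_eq; rewrite /= mulmx1.
- by move=> a b f; apply: free_over_hom_eq; rewrite /= mul1mx.
- by move=> a b c d h g f; apply: free_over_hom_eq; rewrite /= mulmxA.
Defined.

(** Two objects map to their direct sum. Two parallel matrices are equalized by an endomorphism of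
    the target that is the identity modulo the row space of their difference; it lies over V because
    the map to V kills that row space. *)
Lemma free_over_filtered : filtered free_over_cat.
Proof.
split.
- by exists (@FreeOver 0 \0).
- move=> a b.
  have lin : linear (fun x : 'rV[k]_(fo_rank a + fo_rank b) =>
      fo_map a (lsubmx x) + fo_map b (rsubmx x)).
    move=> c x y; rewrite !linearP /= scalerDr !addrA; congr (_ + _).
    by rewrite -!addrA; congr (_ + _); rewrite addrC.
  have fP x : linear_of lin (x *m row_mx 1%:M 0) = fo_map a x.
    by rewrite /= mul_mx_row mulmx1 mulmx0 row_mxKl row_mxKr linear0 addr0.
  have gP x : linear_of lin (x *m row_mx 0 1%:M) = fo_map b x.
    by rewrite /= mul_mx_row mulmx1 mulmx0 row_mxKl row_mxKr linear0 add0r.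
  by exists (FreeOver (linear_of lin)), (@FreeOverHom a (FreeOver _) _ fP),
    (@FreeOverHom b (FreeOver _) _ gP).
- move=> a b f g.
  (* An idempotent whose kernel is the row space of the difference. *)
  pose d := fh_mx f - fh_mx g; pose e := 1%:M - pinvmx d *m d.
  have eP x : fo_map b (x *m e) = fo_map b x.
    rewrite mulmxBr mulmx1 linearB /= mulmxA mulmxBr linearB /= !fh_map.
    by rewrite subrr subr0.
  exists b, (FreeOverHom eP); apply: free_over_hom_eq => /=.
  (* The generalized inverse satisfies [d *m pinvmx d *m d = d], so [d *m e = 0]. *)
  apply/eqP; rewrite -subr_eq0 -mulmxBl -/d mulmxBr mulmx1 mulmxA.
  by rewrite mulmxKpV ?submx_refl ?subrr.
Qed.

Lemma vector_map_linear (v : V) : linear (fun x : 'rV[k]_1 => x 0 0 *: v).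
Proof. by move=> c x y; rewrite !mxE scalerDl scalerA. Qed.

Definition fo_vector (v : V) : free_over :=
  FreeOver (linear_of (vector_map_linear v)).

Section Diagram.
Variables (S : grothendieck_cat k).
Implicit Types M N : S.

Definition free_diagram M : diagram S free_over_cat.
Proof.
exists (fun a : free_over_cat => M ⊗ 'rV[k]_(fo_rank a))
  (fun a b f => cmap_vect M (mulmxr (fh_mx f))).
- by move=> a; apply: cin_ext => x; rewrite cmap_vect_in /= mulmx1 comp1m.
- move=> a b c g f; apply: cin_ext => x.
  by rewrite -compmA !cmap_vect_in /= mulmxA.
Defined.

(** A cocone forces the value at a vector [v]: it is read off at the unit vector of the object k ->
    V that picks [v]. *)
Lemma free_diagram_colimit M :
  is_colimit (D := free_diagram M) (fun a => cmap_vect M (fo_map a)).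
Proof.
split=> [a b f|Y d dP].
  by apply: cin_ext => x; rewrite -compmA !cmap_vect_in /= fh_map.
have dE (a b : free_over) (B : 'M[k]_(fo_rank a, fo_rank b)) x :
    (forall y, fo_map b (y *m B) = fo_map a y) ->
    d a • cin M _ x = d b • cin M _ (x *m B).
  move=> h; have := dP a b (FreeOverHom h).
  by move=> <-; rewrite -compmA cmap_vect_in.
pose h v := d (fo_vector v) • cin M _ 1%:M.
have hE a x : d a • cin M _ x = h (fo_map a x).
  (* The row [x], seen as a matrix with one row, is itself a morphism from [fo_vector (fo_map a x)]
     to [a]. *)
  rewrite /h (dE (fo_vector _) a x); first by rewrite mul1mx.
  by move=> y; rewrite [y]mx11_scalar mul_scalar_mx linearZ /= mxE eqxx.
have hlin : linear h.
  move=> c x y.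
  (* Linearity is checked inside a single object: k^2 mapped to V by the pair [x], [y]. *)
  have lin : linear (fun z : 'rV[k]_2 => z 0 0 *: x + z 0 1 *: y).
    move=> c' z z'; rewrite !mxE !scalerDl -!scalerA !scalerDr !addrA.
    by congr (_ + _); rewrite -!addrA; congr (_ + _); rewrite addrC.
  pose a := FreeOver (linear_of lin).
  have e00 : fo_map a (delta_mx 0 0) = x
    by rewrite /= !mxE scale1r scale0r addr0.
  have e01 : fo_map a (delta_mx 0 1) = y
    by rewrite /= !mxE scale1r scale0r add0r.
  rewrite -{1}e00 -{1}e01 -linearP -hE linearP linearPr !hE.
  by rewrite e00 e01.
exists (clift (linear_of hlin)); split=> [a|g gP].
  by apply: cin_ext => x; rewrite -compmA cmap_vect_in clift_in /= -hE.
apply: cin_ext => v; rewrite clift_in /= /h -gP -compmA cmap_vect_in /=.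
by rewrite !mxE eqxx scale1r.
Qed.

Let Sab : abelian S := gr_abelian (gr_catP S).

(** Each stage M ⊗ k^n is exact by the coordinatewise argument, and AB5 passes to the filtered
    colimit. *)
Lemma cmap_obj_short_exact M N P (f : hom M N) (g : hom N P) :
  short_exact f g -> short_exact (cmap_obj f V) (cmap_obj g V).
Proof.
move=> [fk gc].
apply: (gr_ab5 (gr_catP S) free_over_filtered (D := free_diagram M)
  (E := free_diagram N) (F := free_diagram P)
  (alpha := fun a => cmap_obj f 'rV[k]_(fo_rank a))
  (beta := fun a => cmap_obj g 'rV[k]_(fo_rank a)) _ _ _
  (free_diagram_colimit M) (free_diagram_colimit N) (free_diagram_colimit P)).
- by move=> a b h; apply: cmap_vectC.
- by move=> a b h; apply: cmap_vectC.
- by move=> a; split; [apply: cmap_obj_kernel_fin|apply: cmap_obj_cokernel].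
- by move=> a; apply: cmap_vectC.
- by move=> a; apply: cmap_vectC.
Qed.

Lemma cmap_obj_mono M N (f : hom M N) : mono f -> mono (cmap_obj f V).
Proof.
move=> fm; have [Q [p pP]] := ab_cokernel Sab f.
have [fk _] := cmap_obj_short_exact (conj (mono_is_kernel Sab fm pP) pP).
exact: kernel_mono fk.
Qed.

(** Factor [f] as a cokernel [e] of [i] followed by a mono [m]: tensoring keeps the short exact
    sequence of [i] and [e], and keeps [m] mono. *)
Lemma cmap_obj_kernel M N (f : hom M N) K (i : hom K M) :
  is_kernel f i -> is_kernel (cmap_obj f V) (cmap_obj i V).
Proof.
move=> iP; have [I [e [m [eP mm me]]]] := coimage_factorization Sab iP.
rewrite -me cmap_obj_comp; apply: kernel_mono_comp; first exact: cmap_obj_mono.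
apply: (cmap_obj_short_exact (conj _ eP)).1; apply: is_kernelI.
- exact: kernel_mono iP.
- exact: eP.1.
move=> Z h eh; apply: (kernel_lift iP).
by rewrite -me -compmA eh linear0r.
Qed.

End Diagram.
End FreeApproximations.

(** * Hopf modules without axioms *)

Section TensorNaturality.
Variables (k : fieldType) (S : grothendieck_cat k).
Implicit Types (M N P : S) (U V W : lmodType k).

Lemma tensor_cin_ext M N U V (g h : hom (M ⊗ (U ⊗k V)) N) :
  (forall u v, g • cin M _ (tens u v) = h • cin M _ (tens u v)) -> g = h.
Proof.
move=> e; apply: cin_ext => t; rewrite (tensor_sum t) !linear_sum /=.
by apply: eq_bigr => p _; apply: e.
Qed.

Lemma cunit_in M c : cunit M • cin M k^o c = c *: idm M.
Proof. exact: clift_in. Qed.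

Lemma cassoc_in M V W v w :
  cassoc M V W • cin M _ (tens v w) = cin (M ⊗ V) W w • cin M V v.
Proof. by rewrite /cassoc clift_in /= tlift_tens. Qed.

Lemma cassoc_swap_in M V W v w :
  cassoc_swap M V W • cin M _ (tens v w) = cin (M ⊗ W) V v • cin M W w.
Proof. by rewrite /cassoc_swap clift_in /= tlift_tens. Qed.

Lemma cmiddle_in M V A W v a w :
  cmiddle M V A W • cin (M ⊗ V) _ (tens a w) • cin M V v =
  cin (M ⊗ A) _ (tens w v) • cin M A a.
Proof. by rewrite /cmiddle clift_in /= tlift_tens [LHS]clift_in. Qed.

Section Naturality.
Variables (M N : S) (f : hom M N).

Lemma cunit_nat : f • cunit M = cunit N • cmap_obj f k^o.
Proof.
apply: cin_ext => c; rewrite -!compmA cmap_obj_in (compmA (cunit N)) !cunit_in.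
by rewrite linearZl_LR linearZr_LR comp1m compm1.
Qed.

Lemma cassoc_nat V W :
  cmap_obj (cmap_obj f V) W • cassoc M V W = cassoc N V W • cmap_obj f _.
Proof.
apply: tensor_cin_ext => v w.
rewrite -!compmA cassoc_in cmap_obj_in !compmA cmap_obj_in cassoc_in.
by rewrite -!compmA cmap_obj_in.
Qed.

Lemma cassoc_swap_nat V W :
  cmap_obj (cmap_obj f W) V • cassoc_swap M V W =
  cassoc_swap N V W • cmap_obj f _.
Proof.
apply: tensor_cin_ext => v w.
rewrite -!compmA cassoc_swap_in cmap_obj_in !compmA cmap_obj_in cassoc_swap_in.
by rewrite -!compmA cmap_obj_in.
Qed.

Lemma cmiddle_nat V A W :
  cmap_obj (cmap_obj f A) _ • cmiddle M V A W =
  cmiddle N V A W • cmap_obj (cmap_obj f V) _.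
Proof.
apply: tensor_cin_ext => a w; apply: cin_ext => v.
rewrite -!compmA (compmA (cmiddle _ _ _ _)) cmiddle_in.
rewrite (compmA (cmap_obj _ _) (cin _ _ _)) !cmap_obj_in -!compmA cmap_obj_in.
rewrite (compmA (cmap_obj _ _) (cin _ _ _)) cmap_obj_in -!compmA cmap_obj_in.
by rewrite [RHS]compmA compmA -cmiddle_in -!compmA.
Qed.

End Naturality.
End TensorNaturality.

Section RawModules.
Variables (k : fieldType) (S : grothendieck_cat k) (H : hopf_algebra k)
  (A : comodule_algebra H).

(** With the laws split off from the data, both sides of each law can be shown natural in maps that
    respect the data, and the laws can then be transported along such maps. *)
Record raw_hopf_mod :=
  RawHopfMod {
  raw_obj :> S;
  raw_act : hom (raw_obj ⊗ A) raw_obj;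
  raw_coact : hom raw_obj (raw_obj ⊗ H)
}.

Definition raw_of (M : hopf_mod S A) : raw_hopf_mod :=
  RawHopfMod (act M) (coact M).

Section Sides.
Variable M : raw_hopf_mod.
Let a := raw_act M.
Let c := raw_coact M.

Definition act1_l := a • cin M A (alg_one A).
Definition actM_l := a • cmap_vect M (tlift (alg_mul A)).
Definition actM_r := a • cmap_obj a A • cassoc_swap M A A.
Definition counit_l := cunit M • cmap_vect M (heps H) • c.
Definition coassoc_l := cassoc M H H • cmap_vect M (hdelta H) • c.
Definition coassoc_r := cmap_obj c H • c.
Definition coact_act_l := c • a.
Definition coact_act_r :=
  (cmap_vect M (tlift (alg_mul H)) • cmap_obj a (H ⊗k H))
    • cmiddle M H A H • (cmap_obj c (A ⊗k H) • cmap_vect M (rho A)).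

Definition is_hopf_mod : Prop :=
  [/\ act1_l = idm M, actM_l = actM_r, counit_l = idm M, coassoc_l = coassoc_r
    & coact_act_l = coact_act_r].

End Sides.

Lemma raw_hopfP (M : hopf_mod S A) : is_hopf_mod (raw_of M).
Proof.
by case: M => M a c *; split.
Qed.

Definition hopf_of_raw (M : raw_hopf_mod) (MP : is_hopf_mod M) : hopf_mod S A :=
  @HopfMod k S H A M (raw_act M) (raw_coact M)
    (let: And5 h _ _ _ _ := MP in h) (let: And5 _ h _ _ _ := MP in h)
    (let: And5 _ _ h _ _ := MP in h) (let: And5 _ _ _ h _ := MP in h)
    (let: And5 _ _ _ _ h := MP in h).

Definition raw_hom (M N : raw_hopf_mod) (f : hom M N) : Prop :=
  f • raw_act M = raw_act N • cmap_obj f A /\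
  raw_coact N • f = cmap_obj f H • raw_coact M.

Section Naturality.
Variables (M N : raw_hopf_mod) (f : hom M N).
Hypothesis fP : raw_hom f.

Let fa : f • raw_act M = raw_act N • cmap_obj f A := fP.1.
Let fc : cmap_obj f H • raw_coact M = raw_coact N • f := esym fP.2.

Lemma act1_l_nat : f • act1_l M = act1_l N • f.
Proof. by rewrite /act1_l compmA fa -!compmA cmap_obj_in. Qed.

Lemma actM_l_nat : f • actM_l M = actM_l N • cmap_obj f _.
Proof. by rewrite /actM_l compmA fa -!compmA cmap_vectC. Qed.

Lemma actM_r_nat : f • actM_r M = actM_r N • cmap_obj f _.
Proof.
rewrite /actM_r !compmA fa -!compmA -cassoc_swap_nat.
by rewrite (compmA (cmap_obj f A)) -cmap_obj_comp fa cmap_obj_comp !compmA.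
Qed.

Lemma counit_l_nat : f • counit_l M = counit_l N • f.
Proof.
rewrite /counit_l !compmA cunit_nat -!compmA -fc !compmA.
by rewrite -(compmA (cunit N)) cmap_vectC !compmA.
Qed.

Lemma coassoc_l_nat :
  cmap_obj (cmap_obj f H) H • coassoc_l M = coassoc_l N • f.
Proof.
rewrite /coassoc_l !compmA cassoc_nat -(compmA (cassoc _ _ _)) cmap_vectC.
by rewrite -!compmA fc.
Qed.

Lemma coassoc_r_nat :
  cmap_obj (cmap_obj f H) H • coassoc_r M = coassoc_r N • f.
Proof.
by rewrite /coassoc_r compmA -cmap_obj_comp fc cmap_obj_comp -!compmA fc.
Qed.

Lemma coact_act_l_nat :
  cmap_obj f H • coact_act_l M = coact_act_l N • cmap_obj f A.
Proof. by rewrite /coact_act_l compmA fc -!compmA fa. Qed.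

Lemma coact_act_r_nat :
  cmap_obj f H • coact_act_r M = coact_act_r N • cmap_obj f A.
Proof.
rewrite /coact_act_r !compmA cmap_vectC -(compmA _ (cmap_obj f _)).
rewrite -cmap_obj_comp fa cmap_obj_comp -!compmA; do 2 congr (_ • _).
rewrite compmA cmiddle_nat -!compmA; congr (_ • _).
by rewrite compmA -cmap_obj_comp fc cmap_obj_comp -!compmA cmap_vectC.
Qed.

End Naturality.

(** By naturality the two sides of each law agree after composition with every [f i]. The laws take
    values in M, M ⊗ H and (M ⊗ H) ⊗ H, whence the three cancellation hypotheses. The family is
    empty for the zero object, a single map for a subobject, and a pair for a biproduct. *)
Lemma is_hopf_mod_joint_mono (I : Type) (M : raw_hopf_mod)
    (N : I -> raw_hopf_mod) (f : forall i, hom M (N i)) :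
  (forall i, is_hopf_mod (N i)) -> (forall i, raw_hom (f i)) ->
  (forall Z (x y : hom Z M), (forall i, f i • x = f i • y) -> x = y) ->
  (forall V Z (x y : hom Z (M ⊗ V)),
    (forall i, cmap_obj (f i) V • x = cmap_obj (f i) V • y) -> x = y) ->
  (forall V W Z (x y : hom Z ((M ⊗ V) ⊗ W)),
    (forall i, cmap_obj (cmap_obj (f i) V) W • x =
               cmap_obj (cmap_obj (f i) V) W • y) -> x = y) ->
  is_hopf_mod M.
Proof.
move=> NP fP m0 m1 m2; split.
- apply: m0 => i; have [e _ _ _ _] := NP i.
  by rewrite act1_l_nat // e comp1m compm1.
- apply: m0 => i; have [_ e _ _ _] := NP i.
  by rewrite actM_l_nat // actM_r_nat // e.
- apply: m0 => i; have [_ _ e _ _] := NP i.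
  by rewrite counit_l_nat // e comp1m compm1.
- apply: m2 => i; have [_ _ _ e _] := NP i.
  by rewrite coassoc_l_nat // coassoc_r_nat // e.
- apply: m1 => i; have [_ _ _ _ e] := NP i.
  by rewrite coact_act_l_nat // coact_act_r_nat // e.
Qed.

Lemma is_hopf_mod_mono (M N : raw_hopf_mod) (f : hom M N) :
  is_hopf_mod N -> raw_hom f -> mono f -> is_hopf_mod M.
Proof.
move=> NP fP fm.
apply: (@is_hopf_mod_joint_mono unit M (fun=> N) (fun=> f)) => //.
- by move=> Z x y /(_ tt) /fm.
- by move=> V Z x y /(_ tt) e; exact: (cmap_obj_mono fm e).
- by move=> V W Z x y /(_ tt) e; exact: (cmap_obj_mono (cmap_obj_mono fm) e).
Qed.

(** Here the laws are compared on their sources N, N ⊗ A and N ⊗ (A ⊗ A), onto which [f] induces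
    epis. *)
Lemma is_hopf_mod_epi (M N : raw_hopf_mod) (f : hom M N) :
  is_hopf_mod M -> raw_hom f -> epi f -> is_hopf_mod N.
Proof.
move=> [e1 e2 e3 e4 e5] fP fe; split.
- by apply: fe; rewrite -act1_l_nat // e1 comp1m compm1.
- apply: (cmap_obj_epi (V := A ⊗k A) fe).
  by rewrite -actM_l_nat // -actM_r_nat // e2.
- by apply: fe; rewrite -counit_l_nat // e3 comp1m compm1.
- by apply: fe; rewrite -coassoc_l_nat // -coassoc_r_nat // e4.
- apply: (cmap_obj_epi (V := A) fe).
  by rewrite -coact_act_l_nat // -coact_act_r_nat // e5.
Qed.

End RawModules.

(** * The category of Hopf modules is abelian *)

Section HopfAbelian.
Variables (k : fieldType) (S : grothendieck_cat k) (H : hopf_algebra k)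
  (A : comodule_algebra H).

Let Sab : abelian S := gr_abelian (gr_catP S).
Implicit Types M N P : hopf_cat S A.

Definition hopf_hom_of (M N : hopf_mod S A) (f : hom M N) (fP : is_hopf_hom f) :
  @hom k (hopf_cat S A) M N := HopfHom (introT (asboolP _) fP).

Lemma hopf_hom_ext M N (f g : hom M N) : hh_val f = hh_val g -> f = g.
Proof. exact: val_inj. Qed.

Lemma hh_val_congr M N (f g : hom M N) : f = g -> hh_val f = hh_val g.
Proof. by move=> ->. Qed.

Lemma hopf_hom_eq0 M N (f : hom M N) : hh_val f = 0 -> f = 0.
Proof. by move=> f0; apply: hopf_hom_ext; rewrite f0. Qed.

Section Subobject.
Variables (M : hopf_mod S A) (K : S) (i : hom K M) (a : hom (K ⊗ A) K)
  (c : hom K (K ⊗ H)).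
Hypotheses (im : mono i) (ia : i • a = act M • cmap_obj i A)
  (ic : coact M • i = cmap_obj i H • c).

Definition sub_hopf_mod : hopf_mod S A :=
  hopf_of_raw (@is_hopf_mod_mono k S H A (RawHopfMod a c) (raw_of M) i
    (raw_hopfP M) (conj ia ic) im).

Definition sub_hopf_in : @hom k (hopf_cat S A) sub_hopf_mod M :=
  @hopf_hom_of sub_hopf_mod M i (conj ia ic).
End Subobject.

Section Quotient.
Variables (M : hopf_mod S A) (Q : S) (p : hom M Q) (a : hom (Q ⊗ A) Q)
  (c : hom Q (Q ⊗ H)).
Hypotheses (pe : epi p) (pa : p • act M = a • cmap_obj p A)
  (pc : c • p = cmap_obj p H • coact M).

Definition quo_hopf_mod : hopf_mod S A :=
  hopf_of_raw (@is_hopf_mod_epi k S H A (raw_of M) (RawHopfMod a c) p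
    (raw_hopfP M) (conj pa pc) pe).

Definition quo_hopf_proj : @hom k (hopf_cat S A) M quo_hopf_mod :=
  @hopf_hom_of M quo_hopf_mod p (conj pa pc).
End Quotient.

(** The coaction square of [x] ends in K ⊗ H, so it is cancelled through [i ⊗ H], which is mono by
    exactness of - ⊗ H. *)
Lemma hopf_hom_factor_mono (Z K M : hopf_mod S A) (i : hopf_hom K M)
    (x : hom Z K) :
  mono (hh_val i) -> is_hopf_hom (hh_val i • x) -> is_hopf_hom x.
Proof.
move=> im [xa xc]; have [ia ic] := hh_valP i; split.
  by apply: im; rewrite !compmA xa ia cmap_obj_comp compmA.
apply: (cmap_obj_mono (V := H) im).
by rewrite !compmA -ic -!compmA xc cmap_obj_comp -!compmA.
Qed.

Lemma hopf_hom_factor_epi (M Q Z : hopf_mod S A) (p : hopf_hom M Q)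
    (x : hom Q Z) :
  epi (hh_val p) -> is_hopf_hom (x • hh_val p) -> is_hopf_hom x.
Proof.
move=> pe [xa xc]; have [pa pc] := hh_valP p; split.
  apply: (cmap_obj_epi (V := A) pe).
  by rewrite -!compmA -pa compmA xa cmap_obj_comp.
by apply: pe; rewrite -!compmA xc cmap_obj_comp -!compmA pc.
Qed.

Lemma is_kernel_hopf M N (f : hom M N) K (i : hom K M) :
  is_kernel (hh_val f) (hh_val i) -> is_kernel f i.
Proof.
move=> iP; have im := kernel_mono iP; apply: is_kernelI.
- move=> Z x y e; apply: hopf_hom_ext; apply: im.
  exact: (hh_val_congr e).
- by apply: hopf_hom_eq0; exact: iP.1.
move=> Z h fh.
have [l il] := kernel_lift iP (hh_val_congr fh).
have lP : is_hopf_hom l.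
  by apply: (hopf_hom_factor_mono im); rewrite il; apply: hh_valP.
by exists (hopf_hom_of lP); apply: hopf_hom_ext.
Qed.

Lemma is_cokernel_hopf M N (f : hom M N) Q (p : hom N Q) :
  is_cokernel (hh_val f) (hh_val p) -> is_cokernel f p.
Proof.
move=> pP; have pe := cokernel_epi pP; apply: is_cokernelI.
- move=> Z x y e; apply: hopf_hom_ext; apply: pe.
  exact: (hh_val_congr e).
- by apply: hopf_hom_eq0; exact: pP.1.
move=> Z h fh.
have [l il] := cokernel_desc pP (hh_val_congr fh).
have lP : is_hopf_hom l.
  by apply: (hopf_hom_factor_epi pe); rewrite il; apply: hh_valP.
by exists (hopf_hom_of lP); apply: hopf_hom_ext.
Qed.

(** The kernel taken in S carries the structure: the action restricts to it directly, while the
    coaction lifts because K ⊗ H is the kernel of [f ⊗ H]. *)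
Lemma hopf_kernel_exists M N (f : hom M N) :
  exists K (i : @hom k (hopf_cat S A) K M), is_kernel (hh_val f) (hh_val i).
Proof.
have [fa fc] := hh_valP f.
have [K [i iP]] := ab_kernel Sab (hh_val f).
have [|a ia] := kernel_lift (h := act M • cmap_obj i A) iP.
  by rewrite compmA fa -compmA -cmap_obj_comp iP.1 cmap_obj0 linear0r.
have [|c ic] := kernel_lift (h := coact M • i) (cmap_obj_kernel H iP).
  by rewrite compmA -fc -compmA iP.1 linear0r.
exists (sub_hopf_mod (kernel_mono iP) ia (esym ic)).
by exists (sub_hopf_in (kernel_mono iP) ia (esym ic)).
Qed.

Lemma hopf_cokernel_exists M N (f : hom M N) :
  exists Q (p : @hom k (hopf_cat S A) N Q), is_cokernel (hh_val f) (hh_val p).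
Proof.
have [fa fc] := hh_valP f.
have [Q [p pP]] := ab_cokernel Sab (hh_val f).
have [|a pa] := cokernel_desc (h := p • act N) (cmap_obj_cokernel A pP).
  by rewrite -compmA -fa compmA pP.1 linear0l.
have [|c pc] := cokernel_desc (h := cmap_obj p H • coact N) pP.
  by rewrite -compmA fc compmA -cmap_obj_comp pP.1 cmap_obj0 linear0l.
exists (quo_hopf_mod (cokernel_epi pP) (esym pa) pc).
by exists (quo_hopf_proj (cokernel_epi pP) (esym pa) pc).
Qed.

(** The kernel in S underlies a Hopf module, so a mono of Hopf modules already kills it. *)
Lemma hopf_mono M N (f : hom M N) : mono f -> mono (hh_val f).
Proof.
move=> fm; have [K [i iP]] := hopf_kernel_exists f.
apply: (mono_kernel0 iP).
suff -> : i = 0 by [].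
by apply: ((monoP f).1 fm); apply: hopf_hom_eq0; exact: iP.1.
Qed.

Lemma hopf_epi M N (f : hom M N) : epi f -> epi (hh_val f).
Proof.
move=> fe; have [K [i iP]] := hopf_cokernel_exists f.
apply: (epi_cokernel0 iP).
suff -> : i = 0 by [].
by apply: ((epiP f).1 fe); apply: hopf_hom_eq0; exact: iP.1.
Qed.

Lemma hopf_zero_exists : exists M, is_zero M.
Proof.
have [Z /is_zeroP Z0] := ab_zero Sab.
have ZV V : idm (Z ⊗ V) = 0 by rewrite -cmap_obj_id Z0 cmap_obj0.
pose R := @RawHopfMod k S H A Z 0 0.
have RP : is_hopf_mod R.
  have z X (x y : hom X Z) : x = y by apply: ((is_zeroP Z).2 Z0).2.
  have zV V : is_zero (Z ⊗ V) by apply/is_zeroP.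
  (* The empty family is jointly mono here, since parallel morphisms into a zero object agree. *)
  apply: (@is_hopf_mod_joint_mono _ _ _ _ void R (of_void _)
    (fun i : void => match i with end)) => //.
  - by move=> V X x y _; apply: (zV V).2.
  - move=> V W X x y _; have : is_zero ((Z ⊗ V) ⊗ W).
      by apply/is_zeroP; rewrite -cmap_obj_id ZV cmap_obj0.
    by move=> [_]; apply.
exists (hopf_of_raw RP); apply/is_zeroP.
by apply: hopf_hom_ext.
Qed.

Lemma hopf_biproduct M N : exists P (i : @hom k (hopf_cat S A) M P)
  (j : @hom k (hopf_cat S A) N P) (p : @hom k (hopf_cat S A) P M)
  (q : @hom k (hopf_cat S A) P N), is_biproduct i j p q.
Proof.
have [P [i [j [p [q [pi qj pj qi ij]]]]]] :=
  ab_biproduct Sab (hm_obj M) (hm_obj N).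
(* The componentwise action and coaction, written through the injections and projections. *)
pose R := @RawHopfMod k S H A P
  (i • (act M • cmap_obj p A) + j • (act N • cmap_obj q A))
  (cmap_obj i H • (coact M • p) + cmap_obj j H • (coact N • q)).
have ijV V : cmap_obj i V • cmap_obj p V + cmap_obj j V • cmap_obj q V = idm _.
  by rewrite -!cmap_obj_comp -cmap_objD ij cmap_obj_id.
have ijVW V W : cmap_obj (cmap_obj i V) W • cmap_obj (cmap_obj p V) W +
    cmap_obj (cmap_obj j V) W • cmap_obj (cmap_obj q V) W = idm _.
  by rewrite -(cmap_obj_id (P ⊗ V) W) -ijV cmap_objD !cmap_obj_comp.
have pP : raw_hom (M := R) (N := raw_of M) p.
  split; rewrite /= !(linearDl, linearDr) ?compmA -?cmap_obj_comp ?pi ?pj.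
    by rewrite comp1m !linear0l addr0.
  by rewrite cmap_obj_id cmap_obj0 comp1m !linear0l addr0.
have qP : raw_hom (M := R) (N := raw_of N) q.
  split; rewrite /= !(linearDl, linearDr) ?compmA -?cmap_obj_comp ?qi ?qj.
    by rewrite comp1m !linear0l add0r.
  by rewrite cmap_obj_id cmap_obj0 comp1m !linear0l add0r.
have iP : raw_hom (M := raw_of M) (N := R) i.
  split; rewrite /= !(linearDl, linearDr) -?compmA -?cmap_obj_comp ?pi ?qi.
    by rewrite cmap_obj_id cmap_obj0 compm1 !linear0r addr0.
  by rewrite compm1 !linear0r addr0.
have jP : raw_hom (M := raw_of N) (N := R) j.
  split; rewrite /= !(linearDl, linearDr) -?compmA -?cmap_obj_comp ?pj ?qj.
    by rewrite cmap_obj_id cmap_obj0 compm1 !linear0r add0r.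
  by rewrite compm1 !linear0r add0r.
have RP : is_hopf_mod R.
  apply: (@is_hopf_mod_joint_mono _ _ _ _ bool R
    (fun b => if b then raw_of M else raw_of N)
    (fun b => if b as b return hom R (if b then raw_of M else raw_of N)
              then p else q)).
  - by case; apply: raw_hopfP.
  - by case.
  - move=> Z x y e; have /= e1 := e true; have /= e2 := e false.
    exact: (joint_mono2 ij e1 e2).
  - move=> V Z x y e; have /= e1 := e true; have /= e2 := e false.
    exact: (joint_mono2 (ijV V) e1 e2).
  - move=> V W Z x y e; have /= e1 := e true; have /= e2 := e false.
    exact: (joint_mono2 (ijVW V W) e1 e2).
exists (hopf_of_raw RP).
exists (@hopf_hom_of M (hopf_of_raw RP) i iP).
exists (@hopf_hom_of N (hopf_of_raw RP) j jP).
exists (@hopf_hom_of (hopf_of_raw RP) M p pP).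
exists (@hopf_hom_of (hopf_of_raw RP) N q qP).
by split; apply: hopf_hom_ext.
Qed.

(** Monos and epis of Hopf modules are monos and epis in S, hence kernels and cokernels there of
    Hopf morphisms; these universal properties lift back to Hopf modules. *)
Lemma hopf_abelian : abelian (hopf_cat S A).
Proof.
split.
- exact: hopf_zero_exists.
- exact: hopf_biproduct.
- move=> M N f; have [K [i iP]] := hopf_kernel_exists f.
  by exists K, i; apply: is_kernel_hopf.
- move=> M N f; have [Q [p pP]] := hopf_cokernel_exists f.
  by exists Q, p; apply: is_cokernel_hopf.
- move=> M N f /hopf_mono fm; have [Q [p pP]] := hopf_cokernel_exists f.
  by exists Q, p; apply: is_kernel_hopf; apply: mono_is_kernel.
- move=> M N f /hopf_epi fe; have [K [i iP]] := hopf_kernel_exists f.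
  by exists K, i; apply: is_cokernel_hopf; apply: epi_is_cokernel.
Qed.

End HopfAbelian.

(** * Sums of subobjects *)

Section Sums.
Variables (k : fieldType).

(** The composite of [f] with the cokernel of [m] vanishes on a jointly epic family, hence is zero,
    so [f] lifts to [m], the kernel of that cokernel. *)
Lemma factors_joint_epi (C : kcat k) (Cab : abelian C) (I : Type) (W X Y : C)
    (f : hom W Y) (m : hom X Y) (T : I -> C) (w : forall i, hom (T i) W) :
  mono m -> (forall Z (x : hom W Z), (forall i, x • w i = 0) -> x = 0) ->
  (forall i, factors (f • w i) m) -> factors f m.
Proof.
move=> mm we fw; have [Q [q qP]] := ab_cokernel Cab m.
apply: (kernel_lift (mono_is_kernel Cab mm qP)); apply: we => i.
by have [l e] := fw i; rewrite -compmA -e compmA qP.1 linear0l.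
Qed.

Variables (S : grothendieck_cat k).
Let Sab : abelian S := gr_abelian (gr_catP S).

Lemma coproduct_exists (M : S) (I : small) :
  exists X (c : I -> hom M X), forall Y (d : I -> hom M Y),
    exists! h : hom X Y, forall i, h • c i = d i.
Proof.
have [X [c [_ cP]]] := gr_cocomplete (gr_catP S) (constant_diagram M I).
exists X, c => Y d; apply: (cP Y d).
by move=> a b f; rewrite /= compm1; case: b / f.
Qed.

(* The generator makes the sum small: it is the image of a coproduct of copies
   of G indexed by the morphisms out of G that factor through a member of P. *)
Lemma sum_exists (M : S) (P : forall X : S, hom X M -> Prop) :
  exists K (m : hom K M), [/\ mono m, forall X i, P X i -> factors i m
    & forall Z (x : hom K Z),
        (forall X (t : hom X K), P X (m • t) -> x • t = 0) -> x = 0].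
Proof.
have [G Ggen] := gr_generator (gr_catP S).
pose J := {g : hom G M | exists X (i : hom X M), P X i /\ factors g i}.
have [T [c cP]] := coproduct_exists G J.
have [e0 [e0P _]] := cP M (fun j => sval j).
have [L [l lP]] := ab_kernel Sab e0.
have [K [e [m [eP mm me]]]] := coimage_factorization Sab lP.
have mu j : m • (e • c j) = sval j by rewrite compmA me e0P.
have leP X i : P X i -> factors i m.
  move=> Pi; have [Q [q qP]] := ab_cokernel Sab m.
  apply: (kernel_lift (mono_is_kernel Sab mm qP)).
  (* If [q • i] were nonzero, the generator would detect it by some [h]; but [i • h] is one of the
     indices, so it factors through [m]. *)
  apply: contrapT => /Ggen[h]; case.
  have hJ : exists X' (i' : hom X' M), P X' i' /\ factors (i • h) i'.
    by exists X, i; split=> //; exists h.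
  have /= := mu (exist _ (i • h) hJ).
  by rewrite -compmA => <-; rewrite compmA qP.1 !linear0l.
exists K, m; split=> // Z x xP.
apply: (cokernel_epi eP); rewrite linear0l.
have [z [_ zu]] := cP Z (fun=> 0).
have <- : z = 0 by apply: zu => j; rewrite linear0l.
symmetry; apply: zu => j.
have [X [i [Pi [r ir]]]] := svalP j; have [t mt] := leP X i Pi.
have -> : x • e • c j = x • t • r.
  by rewrite -!compmA; congr (_ • _); apply: mm; rewrite mu -ir -mt compmA.
by rewrite xP ?linear0l // mt.
Qed.

Variables (H : hopf_algebra k) (A : comodule_algebra H).
Implicit Types M N : hopf_cat S A.

(** The second conclusion says that the members are jointly epic in S, so identities on the sum can
    be checked on members. *)
Lemma hopf_sum_exists M (P : forall X : hopf_cat S A, hom X M -> Prop) :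
  exists K (s : @hom k (hopf_cat S A) K M), is_subobject_sum P s /\
    forall (Z : S) (x : hom (hm_obj K) Z),
      (forall X (t : @hom k (hopf_cat S A) X K), P X (s • t) ->
         x • hh_val t = 0) -> x = 0.
Proof.
(* The class is passed to S as all morphisms that factor through a mono Hopf member. *)
pose P' (X : S) (i : hom X M) := exists X' (i' : @hom k (hopf_cat S A) X' M),
  [/\ mono i', P X' i' & factors i (hh_val i')].
have [K [m [mm leP epiK]]] := sum_exists P'.
have hle X (i : hom X M) : mono i -> P X i -> exists t, m • t = hh_val i.
  move=> im Pi; apply: leP; exists X, i; split=> //.
  by exists (idm _); rewrite compm1.
(* The insertions at vectors of A, composed with the members, are jointly epic onto K ⊗ A; on each
   one the action is that of a Hopf submodule contained in K. *)
have [a ia] : factors (act M • cmap_obj m A) m.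
  pose I := ({X : S & {t : hom X K | P' X (m • t)}} * A)%type.
  apply: (factors_joint_epi Sab (I := I) (T := fun j => tag j.1)
    (w := fun j => cin K A j.2 • sval (tagged j.1))) => //.
    move=> Z x xw; apply: cin_ext => v; rewrite linear0l.
    apply: epiK => X t Pt; rewrite -compmA.
    exact: (xw (existT _ X (exist _ t Pt), v)).
  move=> [[X [t [X' [i' [im Pi [r ir]]]]]] v] /=.
  have [t' it'] := hle X' i' im Pi; have [ia _] := hh_valP i'.
  exists (t' • (act X' • (cin _ A v • r))).
  rewrite !compmA it' ia -!compmA; congr (_ • _).
  by rewrite !compmA !cmap_obj_in -!compmA ir.
(* K ⊗ H is a subobject of M ⊗ H, so the coaction may be tested on the members. *)
have [c ic] : factors (coact M • m) (cmap_obj m H).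
  pose I := {X : S & {t : hom X K | P' X (m • t)}}.
  apply: (factors_joint_epi Sab (I := I) (T := fun j => tag j)
    (w := fun j => sval (tagged j))).
  - exact: cmap_obj_mono.
  - move=> Z x xw; apply: epiK => X t Pt.
    exact: (xw (existT _ X (exist _ t Pt))).
  move=> [X [t [X' [i' [im Pi [r ir]]]]]] /=.
  have [t' it'] := hle X' i' im Pi; have [_ ic] := hh_valP i'.
  exists (cmap_obj t' H • coact X' • r).
  by rewrite !compmA -cmap_obj_comp it' -ic -!compmA ir.
pose s := sub_hopf_in mm ia (esym ic).
have slift X (i : hom X M) : mono i -> P X i -> factors i s.
  move=> im Pi; have [t it] := hle X i im Pi.
  have tP : is_hopf_hom (M := X) (N := sub_hopf_mod mm ia (esym ic)) t.
    apply: (@hopf_hom_factor_mono _ _ _ _ _ _ _ s) => //=.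
    by rewrite it; apply: hh_valP.
  by exists (hopf_hom_of tP); apply: hopf_hom_ext.
exists (sub_hopf_mod mm ia (esym ic)), s; split; first split.
- move=> Z g h e; apply: hopf_hom_ext; apply: (mm).
  exact: (hh_val_congr e).
- exact: slift.
- move=> Z j jm jP.
  have [l jl] : factors m (hh_val j).
    pose I := {X : S & {t : hom X K | P' X (m • t)}}.
    apply: (factors_joint_epi Sab (I := I) (T := fun j => tag j)
      (w := fun j => sval (tagged j))).
    - exact: hopf_mono.
    - move=> Z' x xw; apply: epiK => X t Pt.
      exact: (xw (existT _ X (exist _ t Pt))).
    move=> [X [t [X' [i' [im Pi [r ir]]]]]] /=.
    have [l jl] := jP X' i' im Pi.
    by exists (hh_val l • r); rewrite compmA -ir -jl.
  have lP : is_hopf_hom (M := sub_hopf_mod mm ia (esym ic)) l.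
    apply: (@hopf_hom_factor_mono _ _ _ _ _ _ _ j); first exact: hopf_mono.
    by rewrite jl; apply: (hh_valP s).
  by exists (hopf_hom_of lP); apply: hopf_hom_ext.
- move=> Z x xP; apply: epiK => X t [X' [i' [im Pi [r ir]]]].
  have [t' st'] := slift X' i' im Pi.
  have -> : t = hh_val t' • r.
    by apply: (mm); rewrite -ir -st' compmA.
  by rewrite compmA xP ?linear0l // st'.
Qed.

End Sums.

(** * The torsion theory *)

Section Integral.
Variables (k : fieldType) (S : grothendieck_cat k) (H : hopf_algebra k)
  (phi : {linear H -> k^o}).

Definition cslide (M : S) : hom (M ⊗ H) M := cunit M • cmap_vect M phi.

Lemma cslide_in M h : cslide M • cin M H h = phi h *: idm M.
Proof. by rewrite /cslide -compmA cmap_vect_in cunit_in. Qed.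

Lemma cslide_nat M N (f : hom M N) : f • cslide M = cslide N • cmap_obj f H.
Proof. by rewrite /cslide compmA cunit_nat -!compmA cmap_vectC. Qed.

Hypotheses (phi_integral : left_integral phi) (phi1 : phi (alg_one H) = 1).
Variable A : comodule_algebra H.
Implicit Types M N : hopf_cat S A.

Lemma pi_phiE (M : hopf_mod S A) : pi_phi phi M = cslide M • coact M.
Proof. by []. Qed.

Lemma pi_phi_nat M N (f : hom M N) :
  hh_val f • pi_phi phi M = pi_phi phi N • hh_val f.
Proof.
have [_ fc] := hh_valP f.
by rewrite !pi_phiE compmA cslide_nat -!compmA fc.
Qed.

(** In Sweedler notation, coassociativity and the integral property give Δ(m_0 φ(m_1)) = m_0 ⊗ m_1
    φ(m_2) = m_0 φ(m_1) ⊗ 1. *)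
Lemma coact_pi_phi (M : hopf_mod S A) :
  coact M • pi_phi phi M = cin M H (alg_one H) • pi_phi phi M.
Proof.
rewrite !pi_phiE compmA cslide_nat -compmA -coact_coassoc !compmA.
congr (_ • _).
have -> : cslide (M ⊗ H) • cassoc M H H = cmap_vect M (slide_r phi).
  apply: tensor_cin_ext => u v.
  rewrite -compmA cassoc_in compmA cslide_in cmap_vect_in /= tlift_tens /=.
  by rewrite linearZl_LR comp1m linearZ.
apply: cin_ext => h; rewrite -!compmA !cmap_vect_in phi_integral cunit_in.
by rewrite linearZr_LR compm1 linearZ.
Qed.

Lemma pi_phi_coinv (M : hopf_mod S A) Z (e : hom Z M) :
  coact M • e = cin M H (alg_one H) • e -> pi_phi phi M • e = e.
Proof.
move=> h; rewrite pi_phiE -compmA h compmA cslide_in phi1 scale1r.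
by rewrite comp1m.
Qed.

Lemma pi_phi_idem (M : hopf_mod S A) :
  pi_phi phi M • pi_phi phi M = pi_phi phi M.
Proof. exact: pi_phi_coinv (coact_pi_phi M). Qed.

(** Since its image is coinvariant, [pi_phi] factors through the equalizer; conversely it fixes the
    equalizer inclusion, which therefore vanishes with it. *)
Lemma torsion_classP M : torsion_class M <-> pi_phi phi M = 0.
Proof.
have [eP eu] := equalizerP (cin M H (alg_one H)) (coact M).
split=> [[_ T]|p0].
  have [l [lP _]] := eu _ (pi_phi phi M) (esym (coact_pi_phi M)).
  by rewrite -lP (T _ l 0) linear0r.
have e0 : equalizer_in (cin M H (alg_one H)) (coact M) = 0.
  by rewrite -(pi_phi_coinv (esym eP)) p0 linear0l.
apply/is_zeroP; have [|l [_ lu]] := eu (coinvariants M) 0.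
  by rewrite !linear0r.
(* The inclusion is zero, so the identity and the zero endomorphism both lift the zero map and
   coincide by uniqueness. *)
have z x : equalizer_in (cin M H (alg_one H)) (coact M) • x = 0
    :> hom (coinvariants M) M.
  by rewrite e0 linear0l.
exact: etrans (esym (lu _ (z _))) (lu _ (z _)).
Qed.

Lemma in_KHP M X (i : hom X M) : in_KH phi i <-> pi_phi phi M • hh_val i = 0.
Proof.
have kP := kernelP (pi_phi phi M); split=> [[l <-]|].
  by rewrite compmA kP.1 linear0l.
exact: kernel_lift.
Qed.

(** Naturality moves [pi_phi] from one side of [i] to the other, and [i] is mono in S as well. *)
Lemma in_KH_mono M X (i : hom X M) : mono i ->
  in_KH phi i <-> torsion_class X.
Proof.
move=> /hopf_mono im; split=> [/in_KHP|/torsion_classP] e.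
  apply/torsion_classP; apply: im.
  by rewrite pi_phi_nat e linear0r.
by apply/in_KHP; rewrite -pi_phi_nat e linear0r.
Qed.

(** Members factor through a zero sum, hence vanish; if all members vanish, the zero subobject is
    their sum. *)
Lemma torsionfree_classP M : torsionfree_class phi M <->
  forall X (i : hom X M), mono i -> in_KH phi i -> i = 0.
Proof.
split=> [[K [s [[_ sP _] [_ K0]]]] X i im /(sP X i im)[l <-]|h].
  by rewrite (K0 _ l 0) linear0r.
have [Z Z0] := hopf_zero_exists S A.
exists Z, 0; split=> //; split.
- by move=> X g f _; apply: Z0.2.
- by move=> X i im /(h X i im) ->; exists 0; rewrite linear0l.
- by move=> X j _ _; exists 0; rewrite linear0r.
Qed.

Lemma torsion_isomorphic M N :
  isomorphic M N -> torsion_class M -> torsion_class N.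
Proof.
move=> [f [g [_ fg]]] /torsion_classP T; apply/torsion_classP.
have fg' : hh_val f • hh_val g = idm _ := hh_val_congr fg.
by rewrite -[LHS]compm1 -fg' compmA -pi_phi_nat T linear0r linear0l.
Qed.

Lemma torsionfree_isomorphic M N :
  isomorphic M N -> torsionfree_class phi M -> torsionfree_class phi N.
Proof.
move=> [f [g [_ fg]]] /torsionfree_classP F; apply/torsionfree_classP.
move=> Z y ym yK; have gm : mono (g • y) by apply: mono_comp (split_mono fg) ym.
have gK : in_KH phi (g • y) by apply/(in_KH_mono gm)/(in_KH_mono ym).
by rewrite -[y]comp1m -fg -compmA (F _ _ gm gK) linear0r.
Qed.

(** The image of [f] is a quotient of M, hence torsion, and a subobject of N, hence zero. *)
Lemma torsion_hom0 M N (f : hom M N) :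
  torsion_class M -> torsionfree_class phi N -> f = 0.
Proof.
move=> /torsion_classP T /torsionfree_classP F.
have [K [i iP]] := hopf_kernel_exists f.
have [I [e [m [eP mm <-]]]] :=
  coimage_factorization (hopf_abelian S A) (is_kernel_hopf iP).
rewrite (F _ m mm) ?linear0l //; apply/(in_KH_mono mm)/torsion_classP.
apply: (hopf_epi (cokernel_epi eP)).
by rewrite -pi_phi_nat T linear0r linear0l.
Qed.

Lemma torsion_decomposition M : exists K Q
    (s : @hom k (hopf_cat S A) K M) (q : @hom k (hopf_cat S A) M Q),
  [/\ torsion_class K, torsionfree_class phi Q & short_exact s q].
Proof.
have Sab := gr_abelian (gr_catP S); have Cab := hopf_abelian S A.
have [K [s [[sm sP _] epiK]]] := hopf_sum_exists (@in_KH k S H A phi M).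
(* The members are jointly epic onto K in S, and [pi_phi] vanishes on each of them. *)
have sK : pi_phi phi M • hh_val s = 0.
  by apply: epiK => X t /in_KHP; rewrite compmA.
have [Q [q qP]] := hopf_cokernel_exists s.
have sP' := mono_is_kernel Sab (hopf_mono sm) qP.
have {}qP := is_cokernel_hopf qP.
exists K, Q, s, q; split.
- by apply/(in_KH_mono sm)/in_KHP.
- apply/torsionfree_classP => Y y ym /(in_KH_mono ym)/torsion_classP yT.
  (* N is the preimage in M of the torsion subobject Y of M/K, obtained as the kernel of M -> Q ->
     Q/Y. *)
  have [R [c cP]] := ab_cokernel Cab y.
  have [N [n nP]] := ab_kernel Cab (c • q).
  have nm := kernel_mono nP.
  have [|r yr] := kernel_lift (h := q • n) (mono_is_kernel Cab ym cP).
    by rewrite compmA nP.1.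
  (* N is an extension of the torsion objects Y and K; an idempotent that
     vanishes on both is zero. *)
  have nT : torsion_class N.
    (* Modulo K, the map [n • pi_phi phi N] passes through [pi_phi phi Y = 0], so it factors through
       [s]. *)
    have [|l sl] := kernel_lift (h := hh_val n • pi_phi phi N) sP'.
      have yr' : hh_val y • hh_val r = hh_val q • hh_val n :=
        hh_val_congr yr.
      by rewrite compmA -yr' -compmA pi_phi_nat yT linear0l linear0r.
    apply/torsion_classP; apply: (hopf_mono nm); rewrite linear0r.
    (* One of the two copies of the idempotent moves to M, where it kills [s]. *)
    rewrite -pi_phi_idem compmA [X in X • _]pi_phi_nat -compmA -sl.
    by rewrite compmA sK linear0l.
  (* Being torsion, N lies in the sum K, so [q • n = 0] and [q] factors through its own composite
     with [c]. Then [c] is a split mono, and [c • y = 0] forces [y = 0]. *)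
  have [t st] := sP N n nm ((in_KH_mono nm).2 nT).
  have cqe := epi_comp (cokernel_epi cP) (cokernel_epi qP).
  have [|u uP] := cokernel_desc (h := q) (epi_is_cokernel Cab cqe nP).
    by rewrite -st compmA qP.1 linear0l.
  have uc : u • c = idm Q.
    by apply: (cokernel_epi qP); rewrite -compmA uP comp1m.
  by apply: (split_mono uc); rewrite cP.1 linear0r.
- by split=> //; apply: mono_is_kernel.
Qed.

End Integral.

Theorem proposition7p3 (k : fieldType) (S : grothendieck_cat k)
    (H : hopf_algebra k) (phi : {linear H -> k^o})
    (phi_integral : left_integral phi) (phi1 : phi (alg_one H) = 1)
    (A : comodule_algebra H) :
  torsion_theory (@torsion_class k S H A) (@torsionfree_class k S H A phi).
Proof.
split.
- exact: hopf_abelian.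
- exact: (torsion_isomorphic phi_integral phi1).
- exact: (torsionfree_isomorphic phi_integral phi1).
- exact: (torsion_hom0 phi_integral phi1).
- exact: (torsion_decomposition phi_integral phi1).
Qed.
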